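(* Let $g\ge2$, let $\rho\colon\pi_1\Sigma_g\to \mathrm{PSL}(2,\mathbb R)$ be the monodromy of a hyperbolic structure on the closed oriented surface $\Sigma_g$ of genus $g$, let $\tilde\rho\colon\pi_1\Sigma_g\to \mathrm{SL}(2,\mathbb R)$ be a lift of $\rho$, and let $\rho_0=\iota\circ\tilde\rho\colon\pi_1\Sigma_g\to \mathrm{SL}(3,\mathbb R)$, where $\iota\begin{pmatrix}a&b\\c&d\end{pmatrix}=\begin{pmatrix}a&0&b\\0&1&0\\c&0&d\end{pmatrix}$. For each homomorphism $\phi\colon\pi_1\Sigma_g\to\mathbb Z/2\mathbb Z=\{0,1\}$ let $\rho_\phi(\gamma)=\rho_0(\gamma)J_{13}^{\phi(\gamma)}$ with $J_{13}=\mathrm{Diag}(-1,1,-1)$. Then: (a) every $\rho_\phi$ is an Anosov representation with the same boundary map as $\rho_0$, namely the map $\mathbb R P^1\to \mathrm{Flag}(\mathbb R P^2)$ sending $[x:y]$ to the flag consisting of the point $[x:0:y]$ and the projective line through $[x:0:y]$ and $[e_2]=[0:1:0]$; (b) the actions of $\pi_1\Sigma_g$ via the representations $\rho_\phi$ on $$\Omega=\{([v],[f])\in \mathrm{Flag}(\mathbb R P^2): [v]\notin L,\ [f]\notin L^*\},\quad L=\{[x:0:y]\},\quad L^*=\{[f]: f(e_2)=0\},$$ are all topologically conjugate to each other: for any homomorphisms $\phi,\psi\colon\pi_1\Sigma_g\to\mathbb Z/2\mathbb Z$ there is a homeomorphism $h\colon\Omega\to\Omega$ with $h\circ\rho_\phi(\gamma)=\rho_\psi(\gamma)\circ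 h$ for all $\gamma\in\pi_1\Sigma_g$.
   Context: $\partial_\infty\mathbb H^2$ is identified with $\mathbb R P^1$ in the usual way, equivariantly for $\mathrm{PSL}(2,\mathbb R)$, and the universal cover of $\Sigma_g$ is identified with $\mathbb H^2$ via the hyperbolic structure. A flag in $\mathbb R P^2$ is a pair $([v],[f])\in P(\mathbb R^3)\times P(\mathbb R^{3*})$ with $f(v)=0$ (a point and a projective line $\ker f$ through it); $\mathrm{Flag}(\mathbb R P^2)$ is the space of flags, on which $\mathrm{SL}(3,\mathbb R)$ acts naturally. Flags $([v_1],[f_1])$ and $([v_2],[f_2])$ are transverse if $f_1(v_2)\ne0$ and $f_2(v_1)\neq 0$. Anosov representation (with respect to the upper triangular Borel subgroup): $\rho\colon\pi_1\Sigma_g\to \mathrm{SL}(3,\mathbb R)$ is Anosov if there is a continuous $\rho$-equivariant map $\xi\colon\partial_\infty\mathbb H^2\to \mathrm{Flag}(\mathbb R P^2)$, called the boundary map of $\rho$, such that (i) $\xi(x)$ and $\xi(y)$ are transverse for all $x\ne y$ in $\partial_\infty\mathbb H^2$; (ii) for $u\in T^1\mathbb H^2$ let $u^+,u^-\in\partial_\infty\mathbb H^2$ be the forward and backward endpoints of the geodesic through $u$, and let $E^\pm\to T^1\mathbb H^2$ be the vector bundles with fibre $E^\pm_u=T_{\xi(u^\pm)}\mathrm{Flag}(\mathbb R P^2)$. The geodesic flow $\phi_t$ lifts to $E^\pm$ by the identity on fibres (endpoints are constant along flow lines). It is required that there are continuous $\pi_1\Sigma_g$-invariant families of norms on $E^\pm$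 and constants $C,a>0$ such that for all $t\ge0$: $\|\phi_t w\|\ge C^{-1}e^{at}\|w\|$ for $w\in E^+$ and $\|\phi_t w\|\le Ce^{-at}\|w\|$ for $w\in E^-$. *)

(* Defs.v *)
(* MathComp-Analysis, over an arbitrary R : realType. *)
From Stdlib Require Import Relation_Operators.
From HB Require Import structures.
From mathcomp Require Import all_boot all_order all_algebra.
From mathcomp Require Import complex.
From mathcomp Require Import all_classical all_reals all_analysis.

Set Implicit Arguments.
Unset Strict Implicit.
Unset Printing Implicit Defensive.

Import Order.TTheory GRing.Theory Num.Theory.
Import numFieldNormedType.Exports.

Local Open Scope classical_set_scope.
Local Open Scope quotient_scope.
Local Open Scope ring_scope.

Definition group_hom (G H : groupType) (f : G -> H) : Prop :=
  {morph f : x y / (x * y)%g >-> (x * y)%g}.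

(* Homomorphisms from a multiplicative group to the additive group Z/2Z. *)
Definition hom_to_Z2 (G : groupType) (phi : G -> 'Z_2) : Prop :=
  {morph phi : x y / (x * y)%g >-> x + y}.

(** * SL(n,R) and PSL(2,R) *)

Section SpecialLinear.
Context (R : realType) (n : nat).

Record SL := MkSL { SLmx :> 'M[R]_n ; _ : \det SLmx == 1 }.

HB.instance Definition _ := [isSub for SLmx].
HB.instance Definition _ := [Choice of SL by <:].

Lemma det_SL (A : SL) : \det A = 1.
Proof. by case: A => A /= /eqP. Qed.

Lemma SL_unit (A : SL) : (A : 'M[R]_n) \in unitmx.
Proof. by rewrite unitmxE det_SL unitr1. Qed.

Fact SL_one_subproof : \det (1%:M : 'M[R]_n) == 1.
Proof. by rewrite det1. Qed.
Definition SL_one := MkSL SL_one_subproof.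

Fact SL_mul_subproof (A B : SL) : \det (A *m B) == 1.
Proof. by rewrite det_mulmx !det_SL mulr1. Qed.
Definition SL_mul (A B : SL) := MkSL (SL_mul_subproof A B).

Fact SL_inv_subproof (A : SL) : \det (invmx A) == 1.
Proof. by rewrite det_inv det_SL invr1. Qed.
Definition SL_inv (A : SL) := MkSL (SL_inv_subproof A).

Fact SL_mulA : associative SL_mul.
Proof. by move=> A B C; apply: val_inj; rewrite /= mulmxA. Qed.
Fact SL_mul1g : left_id SL_one SL_mul.
Proof. by move=> A; apply: val_inj; rewrite /= mul1mx. Qed.
Fact SL_mulg1 : right_id SL_one SL_mul.
Proof. by move=> A; apply: val_inj; rewrite /= mulmx1. Qed.
Fact SL_mulVg : left_inverse SL_one SL_inv SL_mul.
Proof. by move=> A; apply: val_inj; rewrite /= mulVmx // SL_unit. Qed.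
Fact SL_mulgV : right_inverse SL_one SL_inv SL_mul.
Proof. by move=> A; apply: val_inj; rewrite /= mulmxV // SL_unit. Qed.

HB.instance Definition _ :=
  isGroup.Build SL SL_mulA SL_mul1g SL_mulg1 SL_mulVg SL_mulgV.

End SpecialLinear.

Section ProjectiveSpecialLinear.
Context (R : realType).
Local Notation M := (fun A : SL R 2 => SLmx A).

Definition eq_up_to_sign (A B : SL R 2) : bool :=
  (M A == M B) || (M A == - M B).

Fact eq_up_to_sign_equiv : equiv_class_of eq_up_to_sign.
Proof.
rewrite /eq_up_to_sign; split=> [A|A B|B A C]; first by rewrite eqxx.
  by rewrite [M A == M B]eq_sym -[M A == - M B]eqr_oppLR [- M A == _]eq_sym.
move=> /orP[] /eqP -> /orP[] /eqP ->; by rewrite ?opprK ?eqxx ?orbT.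
Qed.

Canonical eq_up_to_sign_rel := EquivRelPack eq_up_to_sign_equiv.

Definition PSL2 : Type := {eq_quot eq_up_to_sign}.
HB.instance Definition _ := Choice.on PSL2.
HB.instance Definition _ := EqQuotient.on PSL2.

Definition PSL2_of (A : SL R 2) : PSL2 := \pi_PSL2 A.

Lemma PSL2_ofP (A B : SL R 2) :
  reflect (PSL2_of A = PSL2_of B) (eq_up_to_sign A B).
Proof. exact: (iffP (eqmodP _ _ _)). Qed.

Definition PSL2_one : PSL2 := PSL2_of 1%g.
Definition PSL2_mul (a b : PSL2) : PSL2 := PSL2_of (repr a * repr b)%g.
Definition PSL2_inv (a : PSL2) : PSL2 := PSL2_of (repr a)^-1%g.

Lemma repr_PSL2_of (A : SL R 2) : eq_up_to_sign (repr (PSL2_of A)) A.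
Proof. by apply/PSL2_ofP; rewrite /PSL2_of reprK. Qed.

Lemma PSL2_of_mul (A B : SL R 2) :
  PSL2_of (A * B)%g = PSL2_mul (PSL2_of A) (PSL2_of B).
Proof.
apply/esym/PSL2_ofP; have := repr_PSL2_of A; have := repr_PSL2_of B.
rewrite /eq_up_to_sign /= => /orP[] /eqP -> /orP[] /eqP ->;
  by rewrite ?mulmxN ?mulNmx ?opprK ?eqxx ?orbT.
Qed.

Lemma PSL2_of_inv (A : SL R 2) : PSL2_of A^-1%g = PSL2_inv (PSL2_of A).
Proof.
apply/esym/PSL2_ofP; have := repr_PSL2_of A.
rewrite /eq_up_to_sign /= => /orP[] /eqP ->; first by rewrite eqxx.
suff -> : invmx (- M A) = - invmx (M A) by rewrite eqxx orbT.
have e : - M A *m - invmx (M A) = 1%:M.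
  by rewrite mulNmx mulmxN opprK mulmxV // SL_unit.
have [uN _] := mulmx1_unit e.
by apply: (can_inj (mulKmx uN)); rewrite mulmxV.
Qed.

Lemma PSL2P (a : PSL2) : exists A, a = PSL2_of A.
Proof. by exists (repr a); rewrite /PSL2_of reprK. Qed.

Fact PSL2_mulA : associative PSL2_mul.
Proof.
move=> a b c; have [A ->] := PSL2P a; have [B ->] := PSL2P b.
have [C ->] := PSL2P c.
by rewrite -!PSL2_of_mul mulgA.
Qed.
Fact PSL2_mul1g : left_id PSL2_one PSL2_mul.
Proof. by move=> a; have [A ->] := PSL2P a; rewrite -PSL2_of_mul mul1g. Qed.
Fact PSL2_mulg1 : right_id PSL2_one PSL2_mul.
Proof. by move=> a; have [A ->] := PSL2P a; rewrite -PSL2_of_mul mulg1. Qed.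
Fact PSL2_mulVg : left_inverse PSL2_one PSL2_inv PSL2_mul.
Proof.
by move=> a; have [A ->] := PSL2P a; rewrite -PSL2_of_inv -PSL2_of_mul mulVg.
Qed.
Fact PSL2_mulgV : right_inverse PSL2_one PSL2_inv PSL2_mul.
Proof.
by move=> a; have [A ->] := PSL2P a; rewrite -PSL2_of_inv -PSL2_of_mul mulgV.
Qed.

HB.instance Definition _ :=
  isGroup.Build PSL2 PSL2_mulA PSL2_mul1g PSL2_mulg1 PSL2_mulVg PSL2_mulgV.

End ProjectiveSpecialLinear.

(** * Projective spaces *)

(* P(V) for V = 'M_(m, n), as nonzero vectors modulo scaling with the quotient
   topology: (m, n) = (k, 1) is P(R^k) and (m, n) = (1, k) is P(R^k* ). *)
Section ProjectiveSpace.
Context (R : realType) (m n : nat).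

Definition nonzero : set 'M[R]_(m, n) := [set v | v != 0].

Definition proportional (v w : nonzero) : bool :=
  `[< exists2 c : R, c != 0 & \val w = c *: \val v >].

Fact proportional_equiv : equiv_class_of proportional.
Proof.
split=> [v|v w|w v x].
- by apply/asboolP; exists 1; rewrite ?oner_eq0 ?scale1r.
- by apply/idP/idP => /asboolP[c c0 e]; apply/asboolP; exists c^-1;
    rewrite ?invr_eq0 // e scalerA mulVf ?scale1r.
- move=> /asboolP[c c0 e] /asboolP[d d0 e']; apply/asboolP.
  by exists (d * c); rewrite ?mulf_neq0 // e' e scalerA.
Qed.

Canonical proportional_rel := EquivRelPack proportional_equiv.

Definition Proj : Type := quotient_topology {eq_quot proportional}.
HB.instance Definition _ := Topological.on Proj.
HB.instance Definition _ := Quotient.on Proj.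

Definition mk_nonzero (v : 'M[R]_(m, n)) (v0 : v != 0) : nonzero :=
  exist _ v (mem_set v0).

Lemma val_nonzero (v : nonzero) : \val v != 0.
Proof. exact: set_mem (valP v). Qed.

Definition cls (v : 'M[R]_(m, n)) (v0 : v != 0) : Proj :=
  \pi_Proj (mk_nonzero v0).

(* Homogeneous coordinates: P = [v]. *)
Definition hcoord (v : 'M[R]_(m, n)) (P : Proj) : Prop :=
  exists v0 : v != 0, P = cls v0.

End ProjectiveSpace.

Notation RP1 R := (Proj R 2 1).
Notation RP2 R := (Proj R 3 1).
Notation RP2dual R := (Proj R 1 3).

Section ProjectiveAction.
Context (R : realType) (n : nat).

Fact act_subproof (A : SL R n) (P : Proj R n 1) :
  A *m \val (repr P) != 0.
Proof.
have := val_nonzero (repr P); apply: contra => /eqP e.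
by rewrite -[\val _](mulKmx (SL_unit A)) e mulmx0.
Qed.

(* [v] |-> [A v] *)
Definition act (A : SL R n) (P : Proj R n 1) : Proj R n 1 :=
  cls (act_subproof A P).

Fact dual_act_subproof (A : SL R n) (l : Proj R 1 n) :
  \val (repr l) *m invmx A != 0.
Proof.
have := val_nonzero (repr l); apply: contra => /eqP e.
by rewrite -[\val _](mulmxKV (SL_unit A)) e mul0mx.
Qed.

(* [f] |-> [f o A^-1] *)
Definition dual_act (A : SL R n) (l : Proj R 1 n) : Proj R 1 n :=
  cls (dual_act_subproof A l).

(* f(v) = 0, for l = [f] and P = [v] *)
Definition incident (l : Proj R 1 n) (P : Proj R n 1) : bool :=
  \val (repr l) *m \val (repr P) == 0.

Lemma repr_cls m k (v : 'M[R]_(m, k)) (v0 : v != 0) :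
  exists2 c : R, c != 0 & v = c *: \val (repr (cls v0)).
Proof.
have /eqmodP/asboolP[c c0 e] : repr (cls v0) = mk_nonzero v0
    %[mod {eq_quot @proportional R m k}] by rewrite [LHS]reprK.
by exists c.
Qed.

Lemma incident_cls (f : 'rV[R]_n) (v : 'cV[R]_n) (f0 : f != 0) (v0 : v != 0) :
  incident (cls f0) (cls v0) = (f *m v == 0).
Proof.
have [c c0 {2}->] := repr_cls f0; have [d d0 {2}->] := repr_cls v0.
by rewrite -scalemxAl -scalemxAr !scaler_eq0 (negPf c0) (negPf d0).
Qed.

Lemma incident_act (A : SL R n) (l : Proj R 1 n) (P : Proj R n 1) :
  incident (dual_act A l) (act A P) = incident l P.
Proof. by rewrite incident_cls mulmxA mulmxKV // SL_unit. Qed.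

End ProjectiveAction.

(** * Flags in RP^2 *)

Section Flags.
Context (R : realType).

Definition flag_set : set (RP2 R * RP2dual R) := [set F | incident F.2 F.1].
Definition Flag := set_type flag_set.
HB.instance Definition _ := Topological.on Flag.

Definition flag_pt (F : Flag) : RP2 R := (\val F).1.
Definition flag_line (F : Flag) : RP2dual R := (\val F).2.

Fact flag_act_subproof (A : SL R 3) (F : Flag) :
  (act A (flag_pt F), dual_act A (flag_line F)) \in flag_set.
Proof. by apply/mem_set; rewrite /flag_set /= incident_act; exact: set_mem (valP F). Qed.

Definition flag_act (A : SL R 3) (F : Flag) : Flag :=
  exist (fun x => x \in flag_set) _ (flag_act_subproof A F).

Definition transverse (F1 F2 : Flag) : Prop :=
  ~~ incident (flag_line F1) (flag_pt F2) /\
  ~~ incident (flag_line F2) (flag_pt F1).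

(* Tangent vectors to Flag in homogeneous coordinates: ((v, f), (dv, df)) is the
   velocity ([v], [f])' of a curve of flags lifted to a curve of pairs (v, f)
   with f(v) = 0, moving with velocity (dv, df).  Flag is the quotient of the
   cone {(v, f) | v, f nonzero, f(v) = 0} by rescaling v and f separately, so
   two such data give the same tangent vector iff they are related by
   [tangent_rescale], the differential of a moving rescaling. *)
Definition tvec : Type := ('cV[R]_3 * 'rV[R]_3) * ('cV[R]_3 * 'rV[R]_3).
HB.instance Definition _ := Topological.copy tvec
  (('cV[R]_3 * 'rV[R]_3) * ('cV[R]_3 * 'rV[R]_3))%type.

Definition tangent (F : Flag) (w : tvec) : Prop :=
  let: ((v, f), (dv, df)) := w in
  [/\ hcoord v (flag_pt F), hcoord f (flag_line F) & f *m dv + df *m v = 0].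

Definition tangent_rescale (a b da db : R) (w : tvec) : tvec :=
  let: ((v, f), (dv, df)) := w in
  ((a *: v, b *: f), (a *: dv + da *: v, b *: df + db *: f)).

(* Vector space operations of T_F Flag, on tangent vectors represented over the
   same homogeneous coordinates (v, f) of F. *)
Definition tangent_scale (s : R) (w : tvec) : tvec := (w.1, s *: w.2).
Definition tangent_add (w w' : tvec) : tvec := (w.1, w.2 + w'.2).
Definition tangent_null (w : tvec) : Prop :=
  let: ((v, f), (dv, df)) := w in
  (exists c : R, dv = c *: v) /\ (exists c : R, df = c *: f).

(* The differential of the action of A on Flag. *)
Definition tangent_act (A : SL R 3) (w : tvec) : tvec :=
  let: ((v, f), (dv, df)) := w in
  ((A *m v, f *m invmx A), (A *m dv, df *m invmx A)).

End Flags.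

(** * The hyperbolic plane and its geodesic flow *)

(* Upper half-plane model; the complex number x + i y is the pair (x, y). *)
Section Hyperbolic.
Context (R : realType).

Definition to_C (z : R * R) : R[i] := (z.1 +i* z.2)%C.
Definition of_C (z : R[i]) : R * R := (complex.Re z, complex.Im z).

Definition H2 : set (R * R) := [set z | 0 < z.2].

Definition mobius (A : SL R 2) (z : R * R) : R * R :=
  of_C (((A 0 0)%:C * to_C z + (A 0 1)%:C) / ((A 1 0)%:C * to_C z + (A 1 1)%:C))%C.

(* Unit tangent vectors (z, w) for the metric (dx^2 + dy^2) / y^2. *)
Definition T1H2 : set ((R * R) * (R * R)) :=
  [set u | 0 < u.1.2 /\ u.2.1 ^+ 2 + u.2.2 ^+ 2 = u.1.2 ^+ 2].

(* The differential of [mobius A], whose derivative at z is (c z + d)^-2. *)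
Definition T1_act (A : SL R 2) (u : (R * R) * (R * R)) : (R * R) * (R * R) :=
  (mobius A u.1,
   of_C (to_C u.2 / ((A 1 0)%:C * to_C u.1 + (A 1 1)%:C) ^+ 2)%C).

(* The velocity at time t of the unit speed geodesic t |-> i e^t, which runs
   from 0 = [0:1] to oo = [1:0]. *)
Definition axis_velocity (t : R) : (R * R) * (R * R) :=
  ((0, expR t), (0, expR t)).

(* An isometry carrying the upward unit vector at i to u.  SL(2,R) acts
   transitively on T^1 H^2 with stabilizers {1, -1}, so it exists and is unique
   up to sign; hence what follows does not depend on the choice. *)
Definition frame (u : (R * R) * (R * R)) : SL R 2 :=
  xget 1%g [set A | T1_act A (axis_velocity 0) = u].

Definition geodesic_flow (t : R) (u : (R * R) * (R * R)) :=
  T1_act (frame u) (axis_velocity t).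

Fact basis_vector_neq0 n (i : 'I_n) : (delta_mx i 0 : 'cV[R]_n) != 0.
Proof.
apply/eqP => /matrixP/(_ i 0); rewrite !mxE !eqxx /= => /eqP.
by rewrite oner_eq0.
Qed.

Definition basis_pt n (i : 'I_n) : Proj R n 1 := cls (basis_vector_neq0 i).

(* u^+ and u^-, with the boundary at infinity R u {oo} of H^2 identified with
   RP^1 by x = [x:1], oo = [1:0]. *)
Definition fwd_endpoint (u : (R * R) * (R * R)) : RP1 R :=
  act (frame u) (basis_pt 0).
Definition bwd_endpoint (u : (R * R) * (R * R)) : RP1 R :=
  act (frame u) (basis_pt 1).

(* PSL(2,R) acts through either lift to SL(2,R). *)
Definition PSL2_mobius (a : PSL2 R) := mobius (repr a).
Definition PSL2_T1_act (a : PSL2 R) := T1_act (repr a).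
Definition PSL2_act (a : PSL2 R) : RP1 R -> RP1 R := act (repr a).

End Hyperbolic.

(** * Closed surfaces and hyperbolic structures *)

Section Surfaces.
Context (R : realType).

Definition disk : set (R * R) := [set x | x.1 ^+ 2 + x.2 ^+ 2 <= 1].

(* The point with parameter s in [0, 1] on the k-th of the 4g consecutive sides
   of the disk viewed as a 4g-gon. *)
Definition side (g k : nat) (s : R) : R * R :=
  let theta := 2 * pi * (k%:R + s) / (4 * g)%:R in (cos theta, sin theta).

(* The boundary word a_0 b_0 a_0^-1 b_0^-1 a_1 b_1 a_1^-1 b_1^-1 ... : the sides
   4i and 4i+2, and 4i+1 and 4i+3, are glued with opposite orientations. *)
Definition glued (g : nat) (x y : R * R) : Prop :=
  exists i e : nat, exists s : R,
    [/\ (i < g)%N, (e < 2)%N, 0 <= s <= 1,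
        x = side g (4 * i + e) s & y = side g (4 * i + e + 2) (1 - s)].

(* S is homeomorphic to the closed oriented surface of genus g, the 4g-gon with
   its sides glued as above (for S Hausdorff, q is a quotient map since the disk
   is compact). *)
Definition closed_surface_of_genus (g : nat) (S : topologicalType) : Prop :=
  hausdorff_space S /\
  exists q : R * R -> S,
    [/\ {within disk, continuous q}, q @` disk = setT &
        forall x y, disk x -> disk y ->
          (q x = q y <-> clos_refl_sym_trans _ (glued g) x y)].

(* A hyperbolic structure on S identifies its universal cover with H^2, i.e. it
   is given by a covering p : H^2 -> S with deck transformations in PSL(2,R); its
   monodromy is the resulting action on H^2 of G = pi_1 S, as the group of deck
   transformations.  Thus p is the quotient map for a covering space action of G
   by orientation preserving isometries. *)
Definition hyperbolic_monodromy (S : topologicalType) (G : groupType)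
    (rho : G -> PSL2 R) : Prop :=
  group_hom rho /\
  exists p : R * R -> S,
    [/\ {within @H2 R, continuous p},
        p @` @H2 R = setT,
        (forall U, open U -> open (p @` (U `&` @H2 R))),
        (forall z w, H2 z -> H2 w ->
           (p z = p w <-> exists gamma, w = PSL2_mobius (rho gamma) z)) &
        (forall z, H2 z -> exists2 U, nbhs z U &
           forall gamma w, gamma != 1%g -> H2 w -> U w ->
             ~ U (PSL2_mobius (rho gamma) w))].

End Surfaces.

(** * Anosov representations *)

Section Anosov.
Context (R : realType) (G : groupType) (rho : G -> PSL2 R) (sigma : G -> SL R 3).

(* The total space of the bundle over T^1 H^2 with fibre T_{xi (e u)} Flag at u. *)
Definition total_space (xi : RP1 R -> Flag R)
    (e : (R * R) * (R * R) -> RP1 R) : set (((R * R) * (R * R)) * tvec R) :=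
  [set uw | T1H2 uw.1 /\ tangent (xi (e uw.1)) uw.2].

(* N is a continuous G-invariant family of norms on that bundle. *)
Record invariant_norms (xi : RP1 R -> Flag R)
    (e : (R * R) * (R * R) -> RP1 R)
    (N : ((R * R) * (R * R)) * tvec R -> R) : Prop := {
  fam_well_defined : forall u w a b da db, total_space xi e (u, w) ->
    a != 0 -> b != 0 -> N (u, tangent_rescale a b da db w) = N (u, w);
  fam_homogeneous : forall u w s, total_space xi e (u, w) ->
    N (u, tangent_scale s w) = `|s| * N (u, w);
  fam_triangle : forall u w w', total_space xi e (u, w) -> total_space xi e (u, w') ->
    w.1 = w'.1 -> N (u, tangent_add w w') <= N (u, w) + N (u, w');
  fam_definite : forall u w, total_space xi e (u, w) ->
    N (u, w) = 0 -> tangent_null w;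
  fam_continuous : {within total_space xi e, continuous N};
  fam_invariant : forall gamma u w, total_space xi e (u, w) ->
    N (PSL2_T1_act (rho gamma) u, tangent_act (sigma gamma) w) = N (u, w)
}.

Definition boundary_map (xi : RP1 R -> Flag R) : Prop :=
  [/\ continuous xi,
      (forall gamma x,
         xi (PSL2_act (rho gamma) x) = flag_act (sigma gamma) (xi x)),
      (forall x y, x <> y -> transverse (xi x) (xi y)) &
      exists Np Nm : ((R * R) * (R * R)) * tvec R -> R, exists C a : R,
        [/\ 0 < C /\ 0 < a,
            invariant_norms xi (@fwd_endpoint R) Np,
            invariant_norms xi (@bwd_endpoint R) Nm,
            (forall t u w, 0 <= t -> T1H2 u -> tangent (xi (fwd_endpoint u)) w ->
               C^-1 * expR (a * t) * Np (u, w) <= Np (geodesic_flow t u, w)) &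
            (forall t u w, 0 <= t -> T1H2 u -> tangent (xi (bwd_endpoint u)) w ->
               Nm (geodesic_flow t u, w) <= C * expR (- (a * t)) * Nm (u, w))]].

Definition Anosov : Prop :=
  group_hom sigma /\ exists xi, boundary_map xi.

End Anosov.

(** * The representations and the domain *)

Section Reducible.
Context (R : realType).

Definition vec3 (x y z : R) : 'cV[R]_3 := \col_i [:: x; y; z]`_i.

Definition mx3 (rows : seq (seq R)) : 'M[R]_3 :=
  \matrix_(i, j) (nth [::] rows i)`_j.

Lemma det_mx2 (A : 'M[R]_2) : \det A = A 0 0 * A 1 1 - A 0 1 * A 1 0.
Proof.
rewrite (expand_det_row _ 0) !big_ord_recl big_ord0 /cofactor !det_mx11 !mxE /=.
rewrite expr0 mul1r addr0 expr1 mulN1r mulrN.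
by congr (_ * A _ _ - A _ _ * A _ _); apply: val_inj.
Qed.

Fact iota_subproof (A : SL R 2) :
  \det (mx3 [:: [:: A 0 0; 0; A 0 1]; [:: 0; 1; 0]; [:: A 1 0; 0; A 1 1]]) == 1.
Proof.
rewrite (expand_det_row _ 1) !big_ord_recl big_ord0 /cofactor !det_mx2 !mxE /=.
rewrite !mul0r !addr0 add0r mul1r -[(_ + bump 0 0)%N]/2%N sqrrN expr1n mul1r.
by rewrite -det_mx2 det_SL.
Qed.

Definition iota_emb (A : SL R 2) : SL R 3 := MkSL (iota_subproof A).

Fact J13_subproof :
  \det (mx3 [:: [:: -1; 0; 0]; [:: 0; 1; 0]; [:: 0; 0; -1]]) == 1.
Proof.
rewrite (expand_det_row _ 1) !big_ord_recl big_ord0 /cofactor !det_mx2 !mxE /=.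
rewrite !mul0r !addr0 add0r mul1r -[(_ + bump 0 0)%N]/2%N sqrrN expr1n mul1r.
by rewrite subr0 mulrNN mul1r.
Qed.

Definition J13 : SL R 3 := MkSL J13_subproof.

Definition rho_0 (G : groupType) (rhot : G -> SL R 2) (gamma : G) : SL R 3 :=
  iota_emb (rhot gamma).

Definition rho_twist (G : groupType) (rhot : G -> SL R 2) (phi : G -> 'Z_2)
    (gamma : G) : SL R 3 :=
  (rho_0 rhot gamma * J13 ^+ phi gamma)%g.

Definition L : set (RP2 R) := [set P | exists x y, hcoord (vec3 x 0 y) P].

Definition Ldual : set (RP2dual R) := [set l | incident l (basis_pt R 1)].

Definition Omega : set (Flag R) :=
  [set F | ~ L (flag_pt F) /\ ~ Ldual (flag_line F)].

(* xi [x:y] is the point [x:0:y] together with the line through it and [e_2];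
   the line contains the point because xi [x:y] is a flag. *)
Definition standard_map (xi : RP1 R -> Flag R) : Prop :=
  forall (P : RP1 R) (v : 'cV[R]_2), hcoord v P ->
    hcoord (vec3 (v 0 0) 0 (v 1 0)) (flag_pt (xi P)) /\
    incident (flag_line (xi P)) (basis_pt R 1).

(* h restricts to a homeomorphism of A. *)
Definition homeomorphism_of (T : topologicalType) (A : set T) (h : T -> T) :=
  exists h' : T -> T,
    [/\ {homo h : x / A x} /\ {homo h' : x / A x},
        (forall x, A x -> h' (h x) = x),
        (forall x, A x -> h (h' x) = x),
        {within A, continuous h} &
        {within A, continuous h'}].

End Reducible.

(* Main.v *)
Require Import Defs.
From Stdlib Require Import Relation_Operators.
From mathcomp Require Import all_boot all_order all_algebra.
From mathcomp Require Import complex.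
From mathcomp Require Import all_classical all_reals all_analysis.
From mathcomp Require Import ring lra.

Set Implicit Arguments.
Unset Strict Implicit.
Unset Printing Implicit Defensive.

Import Order.TTheory GRing.Theory Num.Theory.
Import numFieldNormedType.Exports.

Local Open Scope classical_set_scope.
Local Open Scope ring_scope.

(** The representation rho_0 extends to SL(2,R), and a twist rho_phi is again
    iota composed with a lift of rho, namely x |-> (-1)^(phi x) rhot x.  So it
    suffices to treat all lifts at once.

    (a) The flag curve is SL(2,R)-equivariant.  On the tangent spaces of Flag
    along it, an invariant family of norms is obtained from the norms
    |v - z w|^2 / Im z on R^2 attached to the points z of H2; along the geodesic
    from 0 to oo these are diagonal with entries exp(-t) and exp(t), which gives
    the rates directly.

    (b) Omega is SL(2,R) with the action by left translations.  If u : H2 -> S^1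
    satisfies u(gamma z) = chi(gamma) u(z) with chi = (-1)^(phi + psi), then
    rotating the fibre of SL(2,R) -> H2 over z from the right by u(z) conjugates
    the two actions.  Such a u exists because chi lifts to an integral class on
    the surface: lift the defining 4g-gon to H2 and take exp(i pi F), where F is
    the cone over a piecewise linear function on the boundary of the polygon
    whose jumps across the side pairings are integers of the prescribed parity.
    The two sides of a pair contribute opposite increments, so F closes up. *)

(** * The action of SL(2,R) on the upper half-plane *)

Section HyperbolicPlane.
Context (R : realType).
Implicit Types (A B : SL R 2) (z : R * R).

(** A sign-valued equivariant function on the connected space [H2] exists only for trivial chi. The
    circle helps because the rotations form a connected group that contains -1 and, acting from the
    right, commutes with left translations. The integral lift of chi meets no obstruction: each side
    pair occurs once in each direction in the boundary word, so the 2g jumps may be prescribed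
    freely. The polygon is parametrised by the square in polar coordinates because a lift over a
    rectangle can be assembled from lifts over smaller rectangles meeting in an edge; the
    identifications hidden by this parametrisation (centre, cut ray, side pairs) are recovered from
    the uniqueness of lifts of paths. In (a) the fibres of E^+ and E^- are constant along a flow
    line, so all growth comes from the norm. If the square norm of the line in R^2 belonging to the
    endpoint changes by [k^2], the three root coordinates are multiplied by [k^-1], [k^-2] and
    [k^-1]. *)

Lemma SL2_det A : A 0 0 * A 1 1 - A 0 1 * A 1 0 = 1.
Proof. by rewrite -det_mx2 det_SL. Qed.

(** This is [|c z + d|^2] for the bottom row [(c, d)] of [A], the factor by which the imaginary part
    is divided. *)
Definition cocycle_norm A z := (A 1 0 * z.1 + A 1 1) ^+ 2 + (A 1 0 * z.2) ^+ 2.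

Lemma cocycle_norm_gt0 A z : H2 z -> 0 < cocycle_norm A z.
Proof.
rewrite /H2 /= => y0; rewrite /cocycle_norm.
have [c0|c0] := eqVneq (A 1 0) 0.
  have := SL2_det A; rewrite c0 !mul0r mulr0 subr0 add0r expr0n addr0 => e.
  rewrite exprn_even_gt0 //=; apply/eqP => d0.
  by move: e; rewrite d0 mulr0 => /eqP; rewrite eq_sym oner_eq0.
by rewrite ltr_wpDl ?sqr_ge0 // exprn_even_gt0 //= mulf_neq0 // gt_eqF.
Qed.

Lemma to_C_affine (a b : R) z :
  (a%:C * to_C z + b%:C = (a * z.1 + b) +i* (a * z.2))%C.
Proof.
case: z => x y; apply/eqP; rewrite eq_complex /=.
by apply/andP; split; apply/eqP; ring.
Qed.

Lemma mobiusE A z : mobius A z =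
  (((A 0 0 * z.1 + A 0 1) * (A 1 0 * z.1 + A 1 1) + A 0 0 * A 1 0 * z.2 ^+ 2)
     / cocycle_norm A z, z.2 / cocycle_norm A z).
Proof.
case: z => x y; rewrite /mobius !to_C_affine /of_C /cocycle_norm /=.
set u := A 1 0 * x + A 1 1; set v := A 1 0 * y.
move: (u ^+ 2 + v ^+ 2)^-1 => d; rewrite /u /v; congr pair; first by ring.
(* The identity uses [det A = 1], which [ring] cannot see, so the factor 1 is written out as the
   determinant. The same device recurs below. *)
by rewrite -[y * d]mul1r -(SL2_det A); ring.
Qed.

Lemma mobius_H2 A z : H2 z -> H2 (mobius A z).
Proof.
by move=> hz; rewrite mobiusE; apply: divr_gt0 => //; apply: cocycle_norm_gt0.
Qed.

Lemma to_C_cocycle_neq0 A z : H2 z ->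
  ((A 1 0)%:C * to_C z + (A 1 1)%:C)%C != 0.
Proof.
move=> hz; have := cocycle_norm_gt0 A hz; rewrite to_C_affine /cocycle_norm.
apply: contraTneq => /eqP; rewrite eq_complex /= => /andP[/eqP-> /eqP->].
by rewrite expr0n addr0 ltxx.
Qed.

Lemma to_CK : cancel (@to_C R) (@of_C R). Proof. by case. Qed.
Lemma of_CK : cancel (@of_C R) (@to_C R). Proof. by case. Qed.

Lemma SL_mulE n (A B : SL R n) i j : (A * B)%g i j = \sum_k A i k * B k j.
Proof. by rewrite /= mxE. Qed.

Lemma SL2_mulE A B i j : (A * B)%g i j = A i 0 * B 0 j + A i 1 * B 1 j.
Proof.
rewrite SL_mulE !big_ord_recl big_ord0 addr0.
by congr (_ + A i _ * B _ j); apply: val_inj.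
Qed.

(** [B] sends the column [(z, 1)] to [(c z + d) (B z, 1)]. Applying [A] and reading off the second
    entry gives this cocycle identity, which makes [mobius] an action. *)
Lemma to_C_cocycleM A B z : H2 z ->
  (((A * B)%g 1 0)%:C * to_C z + ((A * B)%g 1 1)%:C =
   ((A 1 0)%:C * to_C (mobius B z) + (A 1 1)%:C)
     * ((B 1 0)%:C * to_C z + (B 1 1)%:C))%C.
Proof.
move=> hz; have Bz := to_C_cocycle_neq0 B hz.
rewrite /mobius of_CK !SL2_mulE !rmorphD !rmorphM /=; field.
exact: Bz.
Qed.

Lemma mobiusM A B z : H2 z -> mobius (A * B)%g z = mobius A (mobius B z).
Proof.
move=> hz; rewrite [LHS]/mobius [RHS]/mobius; congr of_C.
rewrite to_C_cocycleM //.
have Bz := to_C_cocycle_neq0 B hz.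
have ABz := to_C_cocycle_neq0 A (mobius_H2 B hz).
move: ABz; rewrite /mobius of_CK !SL2_mulE !rmorphD !rmorphM /= => ABz.
field; rewrite Bz /=; move: ABz; apply: contra => /eqP e; apply/eqP.
apply: (mulIf Bz); rewrite mul0r -[RHS]e; field; exact: Bz.
Qed.

Lemma mobius1 z : mobius 1%g z = z.
Proof.
rewrite mobiusE /cocycle_norm /= !mxE /=; case: z => x y /=.
by congr pair; rewrite !(mul0r, mul1r, add0r, addr0, expr0n, expr1n, mulr0, divr1, mulr1).
Qed.

Lemma mobius_eq_up_to_sign A B z : eq_up_to_sign A B -> mobius A z = mobius B z.
Proof.
rewrite !mobiusE /cocycle_norm => /orP[/eqP-> //|/eqP->]; rewrite !mxE.
by congr (_ / _, _ / _); ring.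
Qed.

Lemma PSL2_mobius_of A z : PSL2_mobius (PSL2_of A) z = mobius A z.
Proof. by apply: mobius_eq_up_to_sign; apply: repr_PSL2_of. Qed.

(* The family of Euclidean norms on R^2 parametrised by H2: the norm at
   [mobius A i] is the push-forward by [A] of the standard one. *)
Definition qform z (x y : R) := ((x - z.1 * y) ^+ 2 + (z.2 * y) ^+ 2) / z.2.

(** [x - z y] is the determinant of the columns [(x, y)] and [(z, 1)], so [A] changes it only by the
    factor [c z + d] that renormalises [(z, 1)]; its absolute square cancels against the change of
    the imaginary part. *)
Lemma qform_mobius A z x y : H2 z ->
  qform (mobius A z) (A 0 0 * x + A 0 1 * y) (A 1 0 * x + A 1 1 * y) = qform z x y.
Proof.
move=> hz; have D0 := cocycle_norm_gt0 A hz; have y0 : 0 < z.2 by [].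
(* With the factor [det^2] both sides are homogeneous of the same degree in the entries of [A], and
   [field] applies. *)
transitivity ((A 0 0 * A 1 1 - A 0 1 * A 1 0) ^+ 2 * qform z x y); last first.
  by rewrite SL2_det expr1n mul1r.
have e : (mobius A z).2 ^+ 2 = ((A 0 0 * A 1 1 - A 0 1 * A 1 0) * z.2 / cocycle_norm A z) ^+ 2.
  by rewrite mobiusE /= SL2_det mul1r.
rewrite /qform exprMn e mobiusE /=.
move: D0; rewrite /cocycle_norm => D0.
by field; rewrite !gt_eqF.
Qed.

Lemma qform_gt0 z x y : H2 z -> (x != 0) || (y != 0) -> 0 < qform z x y.
Proof.
rewrite /H2 /= => hz h; rewrite /qform divr_gt0 //.
have [y0|y0] := eqVneq y 0.
  rewrite y0 eqxx orbF in h *; rewrite !mulr0 subr0 expr0n addr0.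
  by rewrite exprn_even_gt0.
by rewrite ltr_wpDl ?sqr_ge0 // exprn_even_gt0 //= mulf_neq0 // gt_eqF.
Qed.

Lemma qformZ z k x y : qform z (k * x) (k * y) = k ^+ 2 * qform z x y.
Proof. by rewrite /qform; ring. Qed.

End HyperbolicPlane.

(** * Homogeneous coordinates *)

Section ProjectiveCoordinates.
Context (R : realType).

Lemma cls_eqP m n (v w : 'M[R]_(m, n)) (v0 : v != 0) (w0 : w != 0) :
  cls v0 = cls w0 <-> exists2 c : R, c != 0 & w = c *: v.
Proof.
split=> [e|[c c0 e]].
  have [c c0 ev] := repr_cls v0; have [d d0 ew] := repr_cls w0.
  exists (d / c); first by rewrite mulf_neq0 ?invr_eq0.
  by rewrite [in RHS]ev e scalerA divfK // -ew.
by apply/eqmodP/asboolP; exists c.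
Qed.

Lemma hcoord_cls m n (v w : 'M[R]_(m, n)) (w0 : w != 0) c :
  c != 0 -> v = c *: w -> hcoord v (cls w0).
Proof.
move=> c0 e; have v0 : v != 0 by rewrite e scaler_eq0 negb_or c0.
by exists v0; apply/cls_eqP; exists c.
Qed.

Lemma hcoord_repr m n (P : Proj R m n) : hcoord (\val (repr P)) P.
Proof.
have v0 := val_nonzero (repr P); exists v0; rewrite -[LHS]reprK.
by apply/eqmodP/asboolP; exists 1; rewrite ?oner_eq0 ?scale1r.
Qed.

Lemma hcoord_prop m n (v w : 'M[R]_(m, n)) P :
  hcoord v P -> hcoord w P -> exists2 c : R, c != 0 & w = c *: v.
Proof. by move=> [v0 ->] [w0 /cls_eqP]. Qed.

Lemma hcoord_eq m n (v : 'M[R]_(m, n)) P Q : hcoord v P -> hcoord v Q -> P = Q.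
Proof.
move=> [v0 ->] [w0 ->]; apply/cls_eqP.
by exists 1; rewrite ?oner_eq0 ?scale1r.
Qed.

Lemma hcoord_neq0 m n (v : 'M[R]_(m, n)) P : hcoord v P -> v != 0.
Proof. by case. Qed.

Lemma hcoord_scale m n (v : 'M[R]_(m, n)) P c :
  c != 0 -> hcoord v P -> hcoord (c *: v) P.
Proof. by move=> c0 [v0 ->]; apply: (hcoord_cls v0 c0). Qed.

Lemma hcoord_act n (A : SL R n) v P : hcoord v P -> hcoord (A *m v) (act A P).
Proof.
move=> hv; have [c c0 e] := hcoord_prop (hcoord_repr P) hv.
by apply: (hcoord_cls _ c0); rewrite e scalemxAr.
Qed.

Lemma hcoord_dual_act n (A : SL R n) f l :
  hcoord f l -> hcoord (f *m invmx A) (dual_act A l).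
Proof.
move=> hf; have [c c0 e] := hcoord_prop (hcoord_repr l) hf.
by apply: (hcoord_cls _ c0); rewrite e scalemxAl.
Qed.

Lemma incident_hcoord n (l : Proj R 1 n) (P : Proj R n 1) f v :
  hcoord f l -> hcoord v P -> incident l P = (f *m v == 0).
Proof. by move=> [f0 ->] [v0 ->]; rewrite incident_cls. Qed.

Implicit Types (a b c x y z : R).

Definition row3 (a b c : R) : 'rV[R]_3 := \row_j [:: a; b; c]`_j.

Lemma ord3P (P : 'I_3 -> Prop) : P 0 -> P 1 -> P 2 -> forall i, P i.
Proof.
move=> P0 P1 P2; case=> [[|[|[|//]]]] i.
- by rewrite (_ : Ordinal i = 0) //; apply: val_inj.
- by rewrite (_ : Ordinal i = 1) //; apply: val_inj.
- by rewrite (_ : Ordinal i = 2) //; apply: val_inj.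
Qed.

Lemma sum_ord3 (V : nmodType) (F : 'I_3 -> V) : \sum_i F i = F 0 + F 1 + F 2.
Proof.
rewrite !big_ord_recl big_ord0 addr0 addrA.
by congr (F _ + F _ + F _); apply: val_inj.
Qed.

Lemma vec3_eta (v : 'cV[R]_3) : v = vec3 (v 0 0) (v 1 0) (v 2 0).
Proof. by apply/colP; apply: ord3P; rewrite !mxE. Qed.

Lemma row3_eta (f : 'rV[R]_3) : f = row3 (f 0 0) (f 0 1) (f 0 2).
Proof. by apply/rowP; apply: ord3P; rewrite !mxE. Qed.

Lemma vec3Z c x y z : c *: vec3 x y z = vec3 (c * x) (c * y) (c * z).
Proof. by apply/colP; apply: ord3P; rewrite !mxE. Qed.

Lemma row3Z c x y z : c *: row3 x y z = row3 (c * x) (c * y) (c * z).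
Proof. by apply/rowP; apply: ord3P; rewrite !mxE. Qed.

Lemma vec3_neq0 x y z : (vec3 x y z != 0) = [|| x != 0, y != 0 | z != 0].
Proof.
rewrite -!negb_and; congr (~~ _); apply/eqP/and3P => [|[/eqP-> /eqP-> /eqP->]].
  by move=> /colP e; split; apply/eqP; [have := e 0|have := e 1|have := e 2];
     rewrite !mxE.
by apply/colP; apply: ord3P; rewrite !mxE.
Qed.

Lemma row3_neq0 x y z : (row3 x y z != 0) = [|| x != 0, y != 0 | z != 0].
Proof.
rewrite -!negb_and; congr (~~ _); apply/eqP/and3P => [|[/eqP-> /eqP-> /eqP->]].
  by move=> /rowP e; split; apply/eqP; [have := e 0|have := e 1|have := e 2];
     rewrite !mxE.
by apply/rowP; apply: ord3P; rewrite !mxE.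
Qed.

Lemma row3_vec3 a b c x y z :
  row3 a b c *m vec3 x y z = (a * x + b * y + c * z)%:M.
Proof.
by apply/rowP => j; rewrite !mxE sum_ord3 !mxE ord1 eqxx mulr1n.
Qed.

Lemma row3_vec3_eq0 a b c x y z :
  (row3 a b c *m vec3 x y z == 0) = (a * x + b * y + c * z == 0).
Proof.
rewrite row3_vec3; apply/eqP/eqP => [/rowP/(_ 0)|->]; first by rewrite !mxE eqxx.
by apply/rowP => j; rewrite !mxE mul0rn.
Qed.

Lemma iota_vec3 (A : SL R 2) x y z :
  iota_emb A *m vec3 x y z =
  vec3 (A 0 0 * x + A 0 1 * z) y (A 1 0 * x + A 1 1 * z).
Proof.
by apply/colP; apply: ord3P; rewrite !mxE sum_ord3 !mxE /=;
   rewrite ?(mul0r, mul1r, addr0, add0r).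
Qed.

Lemma row3_iota (A : SL R 2) x y z :
  row3 x y z *m iota_emb A =
  row3 (x * A 0 0 + z * A 1 0) y (x * A 0 1 + z * A 1 1).
Proof.
by apply/rowP; apply: ord3P; rewrite !mxE sum_ord3 !mxE /=;
   rewrite ?(mulr0, mulr1, addr0, add0r).
Qed.

Lemma row3_iotaV (A : SL R 2) x y z :
  row3 x y z *m invmx (iota_emb A) =
  row3 (x * A 1 1 - z * A 1 0) y (z * A 0 0 - x * A 0 1).
Proof.
apply: (can_inj (mulmxK (SL_unit (iota_emb A)))).
rewrite mulmxKV ?SL_unit // row3_iota.
have d := SL2_det A.
by congr row3; [rewrite -[LHS]mulr1 -d|rewrite -[LHS]mulr1 -d]; ring.
Qed.

Lemma iota_embM : {morph @iota_emb R : A B / (A * B)%g}.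
Proof.
move=> A B; apply: val_inj; apply/matrixP => i j.
rewrite [RHS]mxE sum_ord3; move: i j.
have e k l : \sum_(j < 2) A k j * B j l = A k 0 * B 0 l + A k 1 * B 1 l.
  by rewrite -SL2_mulE SL_mulE.
by apply: ord3P; apply: ord3P; rewrite !mxE /= ?e; ring.
Qed.

Lemma flag_hcoordP (F F' : Flag R) v f :
  hcoord v (flag_pt F) -> hcoord f (flag_line F) ->
  hcoord v (flag_pt F') -> hcoord f (flag_line F') -> F = F'.
Proof.
move=> hv hf hv' hf'; apply: val_inj.
rewrite [LHS]surjective_pairing [RHS]surjective_pairing.
by congr pair; [apply: hcoord_eq hv hv'|apply: hcoord_eq hf hf'].
Qed.

End ProjectiveCoordinates.

(** * The boundary map *)

Section BoundaryMap.
Context (R : realType).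

Local Notation p0 P := (\val (repr P) 0 0).
Local Notation p1 P := (\val (repr P) 1 0).

Lemma col2_neq0 (v : 'cV[R]_2) : v != 0 -> (v 0 0 != 0) || (v 1 0 != 0).
Proof.
apply: contraNT; rewrite negb_or !negbK => /andP[/eqP e0 /eqP e1].
apply/eqP/colP => i; rewrite mxE; case: i => [[|[|//]]] i.
  by rewrite -[RHS]e0; congr (v _ 0); apply: val_inj.
by rewrite -[RHS]e1; congr (v _ 0); apply: val_inj.
Qed.

Fact std_pt_subproof (P : RP1 R) : vec3 (p0 P) 0 (p1 P) != 0.
Proof.
by rewrite vec3_neq0 eqxx /=; apply: col2_neq0; apply: val_nonzero.
Qed.

(** The row [(y, 0, -x)] annihilates both [(x, 0, y)] and [e_2], so its kernel is the line joining
    them. *)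
Fact std_line_subproof (P : RP1 R) : row3 (p1 P) 0 (- p0 P) != 0.
Proof.
by rewrite row3_neq0 eqxx /= oppr_eq0 orbC; apply: col2_neq0; apply: val_nonzero.
Qed.

Fact std_flag_subproof (P : RP1 R) :
  (cls (std_pt_subproof P), cls (std_line_subproof P)) \in @flag_set R.
Proof.
apply/mem_set; rewrite /flag_set /= incident_cls row3_vec3_eq0; apply/eqP; ring.
Qed.

Definition std_flag (P : RP1 R) : Flag R :=
  exist (fun F => F \in @flag_set R) _ (std_flag_subproof P).

Lemma std_flag_hcoord P (v : 'cV[R]_2) : hcoord v P ->
  hcoord (vec3 (v 0 0) 0 (v 1 0)) (flag_pt (std_flag P)) /\
  hcoord (row3 (v 1 0) 0 (- v 0 0)) (flag_line (std_flag P)).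
Proof.
move=> hv; have [c c0 ->] := hcoord_prop (hcoord_repr P) hv.
split; apply: (hcoord_cls _ c0).
  by rewrite vec3Z !mxE mulr0.
by rewrite row3Z !mxE mulr0 mulrN.
Qed.

Lemma delta_vec3 : (delta_mx 1 0 : 'cV[R]_3) = vec3 0 1 0.
Proof. by apply/colP; apply: ord3P; rewrite !mxE. Qed.

Lemma std_flag_standard : standard_map std_flag.
Proof.
move=> P v hv; have [h1 h2] := std_flag_hcoord hv; split=> //.
rewrite (incident_hcoord h2 (ex_intro _ (basis_vector_neq0 R 1) erefl)).
by rewrite delta_vec3 row3_vec3_eq0 !mulr0 mul0r !addr0.
Qed.

(** The quarter turn [(x, y) -> (y, -x)] intertwines a matrix in SL(2,R) with its inverse transpose,
    so the line coordinates transform as they should. *)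
Lemma std_flag_equivariant (A : SL R 2) P :
  std_flag (act A P) = flag_act (iota_emb A) (std_flag P).
Proof.
have hv := hcoord_repr P.
have [h1 h2] := std_flag_hcoord hv.
have [h3 h4] := std_flag_hcoord (hcoord_act A hv).
apply: (flag_hcoordP h3 h4).
  have := hcoord_act (iota_emb A) h1; rewrite iota_vec3.
  have e i : (A *m \val (repr P)) i 0 = A i 0 * p0 P + A i 1 * p1 P.
    rewrite mxE !big_ord_recl big_ord0 addr0.
    by congr (_ + A i _ * (\val (repr P)) _ 0); apply: val_inj.
  by rewrite !e.
have := hcoord_dual_act (iota_emb A) h2; rewrite row3_iotaV.
have e i : (A *m \val (repr P)) i 0 = A i 0 * p0 P + A i 1 * p1 P.
  rewrite mxE !big_ord_recl big_ord0 addr0.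
  by congr (_ + A i _ * (\val (repr P)) _ 0); apply: val_inj.
rewrite !e; congr hcoord; congr row3; ring.
Qed.

Lemma std_flag_transverse P Q : P <> Q -> transverse (std_flag P) (std_flag Q).
Proof.
move=> PQ; have hP := hcoord_repr P; have hQ := hcoord_repr Q.
have [h1 h2] := std_flag_hcoord hP; have [h3 h4] := std_flag_hcoord hQ.
(* Both pairings are, up to sign, the determinant of the two coordinate vectors, which vanishes only
   if these are proportional. *)
suff D : p1 P * p0 Q - p0 P * p1 Q != 0.
  split; first by rewrite (incident_hcoord h2 h3) row3_vec3_eq0 mul0r addr0 mulNr.
  rewrite (incident_hcoord h4 h1) row3_vec3_eq0 -oppr_eq0.
  by move: D; congr (_ != 0); ring.
apply: contra_notN PQ => /eqP/subr0_eq e.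
have n0 := col2_neq0 (val_nonzero (repr P)).
have m0 := col2_neq0 (val_nonzero (repr Q)).
suff [c c0 [e0 e1]] : exists2 c, c != 0 & p0 Q = c * p0 P /\ p1 Q = c * p1 P.
  apply: (hcoord_eq (v := c *: \val (repr P))); first exact: hcoord_scale.
  have <- // : \val (repr Q) = c *: \val (repr P).
  apply/colP => i; rewrite mxE; case: i => [[|[|//]]] i.
    rewrite (_ : Ordinal i = 0); last exact: val_inj.
    by rewrite e0.
  rewrite (_ : Ordinal i = 1); last exact: val_inj.
  by rewrite e1.
have [z0|z0] := eqVneq (p0 P) 0.
  have z1 : p1 P != 0 by move: n0; rewrite z0 eqxx.
  have q0 : p0 Q = 0.
    by apply: (mulfI z1); rewrite e z0 mul0r mulr0.
  exists (p1 Q / p1 P); last by rewrite z0 q0 mulr0 divfK.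
  by rewrite mulf_neq0 ?invr_eq0 //; move: m0; rewrite q0 eqxx.
have q1 : p1 Q = p0 Q / p0 P * p1 P.
  by apply: (mulfI z0); rewrite -e; field.
exists (p0 Q / p0 P); last by rewrite divfK.
rewrite mulf_neq0 ?invr_eq0 //; apply/eqP => q0.
by move: m0; rewrite q1 q0 mul0r mul0r eqxx.
Qed.

End BoundaryMap.

(** * Continuity at a point, for real functions and for maps into projective and flag spaces *)

Section PointwiseContinuity.
Context (R : realType) (T : topologicalType).
Implicit Types (f g : T -> R) (x : T).

Lemma fun_continuousD f g x : {for x, continuous f} -> {for x, continuous g} ->
  {for x, continuous (fun y => f y + g y)}.
Proof. exact: continuousD. Qed.

Lemma fun_continuousB f g x : {for x, continuous f} -> {for x, continuous g} ->
  {for x, continuous (fun y => f y - g y)}.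
Proof. exact: continuousB. Qed.

Lemma fun_continuousN f x : {for x, continuous f} ->
  {for x, continuous (fun y => - f y)}.
Proof. exact: continuousN. Qed.

Lemma fun_continuousM f g x : {for x, continuous f} -> {for x, continuous g} ->
  {for x, continuous (fun y => f y * g y)}.
Proof. exact: continuousM. Qed.

Lemma fun_continuousX f n x : {for x, continuous f} ->
  {for x, continuous (fun y => f y ^+ n)}.
Proof.
move=> cf; apply: (@continuous_comp _ _ _ f (fun y => y ^+ n)) => //.
exact: exprn_continuous.
Qed.

Lemma fun_continuous_div f g x : g x != 0 ->
  {for x, continuous f} -> {for x, continuous g} ->
  {for x, continuous (fun y => f y / g y)}.
Proof. by move=> g0 cf cg; apply: continuousM => //; apply: continuousV. Qed.

Lemma fun_continuous_norm f x : {for x, continuous f} ->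
  {for x, continuous (fun y => `|f y|)}.
Proof. by move=> cf; apply: continuous_comp => //; exact: norm_continuous. Qed.

Lemma fun_continuous_sqrt f x : {for x, continuous f} ->
  {for x, continuous (fun y => Num.sqrt (f y))}.
Proof. by move=> cf; apply: continuous_comp => //; exact: sqrt_continuous. Qed.

Lemma fun_continuous_fst (U V : topologicalType) (f : T -> U * V) x :
  {for x, continuous f} -> {for x, continuous (fun y => (f y).1)}.
Proof. by move=> cf; apply: continuous_comp => //; exact: cvg_fst. Qed.

Lemma fun_continuous_snd (U V : topologicalType) (f : T -> U * V) x :
  {for x, continuous f} -> {for x, continuous (fun y => (f y).2)}.
Proof. by move=> cf; apply: continuous_comp => //; exact: cvg_snd. Qed.

Lemma fun_continuous_pair (U V : topologicalType) (f : T -> U) (g : T -> V) x :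
  {for x, continuous f} -> {for x, continuous g} ->
  {for x, continuous (fun y => (f y, g y))}.
Proof. by move=> cf cg; apply: cvg_pair cf cg. Qed.

Lemma fun_continuous_coord m n (f : T -> 'M[R]_(m, n)) i j x :
  {for x, continuous f} -> {for x, continuous (fun y => f y i j)}.
Proof.
move=> cf; apply: (@continuous_comp _ _ _ f (fun M => M i j)) => //.
exact: coord_continuous.
Qed.

End PointwiseContinuity.
Arguments fun_continuous_coord {R T m n f} i j {x}.

Section ProjectiveTopology.
Context (R : realType).

Lemma cvg_mx (T : Type) (F : set_system T) {FF : Filter F} m n
    (f : T -> 'M[R]_(m, n)) (M : 'M[R]_(m, n)) :
  (forall i j, f x i j @[x --> F] --> M i j) -> f @ F --> M.
Proof.
move=> cf A /= -[P PM PA]; rewrite nbhs_simpl /=.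
have : F (fun x => forall i j, P i j (f x i j)).
  apply: filter_forall => i; apply: filter_forall => j; exact: cf.
by apply: filterS => x fx; apply: PA.
Qed.

Lemma continuous_at_vec3 (T : topologicalType) (x y z : T -> R) t0 :
  {for t0, continuous x} -> {for t0, continuous y} -> {for t0, continuous z} ->
  {for t0, continuous (fun t => vec3 (x t) (y t) (z t))}.
Proof.
move=> xa yb zc; apply: cvg_mx => i j; move: i j; apply: ord3P => j; rewrite mxE /=.
- by under eq_fun do rewrite mxE /=.
- by under eq_fun do rewrite mxE /=.
- by under eq_fun do rewrite mxE /=.
Qed.

Lemma continuous_at_row3 (T : topologicalType) (x y z : T -> R) t0 :
  {for t0, continuous x} -> {for t0, continuous y} -> {for t0, continuous z} ->
  {for t0, continuous (fun t => row3 (x t) (y t) (z t))}.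
Proof.
move=> xa yb zc; apply: cvg_mx => i j; move: j i; apply: ord3P => j; rewrite mxE /=.
- by under eq_fun do rewrite mxE /=.
- by under eq_fun do rewrite mxE /=.
- by under eq_fun do rewrite mxE /=.
Qed.

(** An open set of [Proj] has as preimage the trace of an open set of matrices on the nonzero ones,
    so a continuous choice of homogeneous coordinates near the point is enough. *)
Lemma continuous_at_cls (T : topologicalType) m n (f : T -> Proj R m n)
    (V : T -> 'M[R]_(m, n)) x0 :
  (\forall x \near x0, hcoord (V x) (f x)) ->
  {for x0, continuous V} -> {for x0, continuous f}.
Proof.
move=> hV cV; have [v0 e0] := nbhs_singleton hV.
move=> A; rewrite nbhsE /= => -[B [oB Bx0] BA].
have [W oW We] := oB.
have Wx0 : W (V x0).
  suff : (set_val @^-1` W) (mk_nonzero v0) by [].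
  by rewrite We /= -[X in B X]e0.
have := cV _ (open_nbhs_nbhs (conj oW Wx0)).
rewrite !nbhs_simpl /= => nW.
apply: filterS2 hV nW => x [vx ex] Wx; apply: BA; rewrite ex.
suff : (set_val @^-1` W) (mk_nonzero vx) by rewrite We.
by [].
Qed.

Lemma continuous_at_flag (T : topologicalType) (f : T -> Flag R) x0 :
  {for x0, continuous (fun x => flag_pt (f x))} ->
  {for x0, continuous (fun x => flag_line (f x))} ->
  {for x0, continuous f}.
Proof.
move=> c1 c2 A; rewrite nbhsE /= => -[B [[W oW WB] Bx0] BA].
have c : (flag_pt (f x), flag_line (f x)) @[x --> x0] -->
    (flag_pt (f x0), flag_line (f x0)) by apply: (cvg_pair c1 c2).
have Wx0 : W (flag_pt (f x0), flag_line (f x0)).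
  by move: Bx0; rewrite -WB /flag_pt /flag_line -surjective_pairing.
have := c _ (open_nbhs_nbhs (conj oW Wx0)).
rewrite !nbhs_simpl /=; apply: filterS => x Wx; apply: BA; rewrite -WB /=.
by move: Wx => /=; rewrite /flag_pt /flag_line -surjective_pairing.
Qed.

End ProjectiveTopology.

(** * Invariant norms on the tangent spaces along the flag curve *)

Section AnosovProperty.
Context (R : realType).

Lemma std_flag_continuous : continuous (@std_flag R).
Proof.
apply/quotient_continuous => v.
have hv : forall w : @nonzero R 2 1, hcoord (\val w) (\pi_(Proj R 2 1)%qT w).
  move=> w; exists (val_nonzero w).
  by apply/eqmodP/asboolP; exists 1; rewrite ?oner_eq0 ?scale1r.
have cc (i : 'I_2) : {for v, continuous (fun w : @nonzero R 2 1 => (\val w) i 0)}.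
  apply: (@continuous_comp _ _ _ set_val (fun M : 'M[R]_(2, 1) => M i 0)).
    exact: initial_continuous.
  exact: coord_continuous.
apply: continuous_at_flag.
  apply: (@continuous_at_cls _ _ _ _ _
    (fun w : @nonzero R 2 1 => vec3 ((\val w) 0 0) 0 ((\val w) 1 0))).
    by near=> w; have [] := std_flag_hcoord (hv w).
  by apply: continuous_at_vec3; [exact: (cc 0)|exact: cst_continuous|exact: (cc 1)].
apply: (@continuous_at_cls _ _ _ _ _
  (fun w : @nonzero R 2 1 => row3 ((\val w) 1 0) 0 (- (\val w) 0 0))).
  by near=> w; have [] := std_flag_hcoord (hv w).
apply: continuous_at_row3; [exact: (cc 1)|exact: cst_continuous|].
exact: (cvgN (cc 0)).
Unshelve. all: by end_near. Qed.

(* In a frame with i as base point, where [v] and [f] are multiples of basis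
   vectors, this is the l^1 norm of the three coordinates of the tangent vector
   with respect to the root space decomposition of T Flag. *)
Definition flag_norm (uw : ((R * R) * (R * R)) * tvec R) : R :=
  let z := uw.1.1 in
  let v := uw.2.1.1 in let f := uw.2.1.2 in
  let dv := uw.2.2.1 in let df := uw.2.2.2 in
  let qv := Num.sqrt (qform z (v 0 0) (v 2 0)) in
  let qf := Num.sqrt (qform z (f 0 2) (- f 0 0)) in
  `|dv 1 0| / qv + `|f 0 0 * dv 0 0 + f 0 1 * dv 1 0 + f 0 2 * dv 2 0| / (qv * qf)
  + `|df 0 1| / qf.

Lemma tangent_std_flagP P (p : 'cV[R]_2) v f dv df : hcoord p P ->
  tangent (std_flag P) ((v, f), (dv, df)) ->
  exists a b : R, [/\ a != 0, b != 0, v = vec3 (a * p 0 0) 0 (a * p 1 0),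
    f = row3 (b * p 1 0) 0 (- (b * p 0 0)) &
    (b * p 1 0) * dv 0 0 - (b * p 0 0) * dv 2 0
      + df 0 0 * (a * p 0 0) + df 0 2 * (a * p 1 0) = 0].
Proof.
move=> hp [hv hf e].
have [h1 h2] := std_flag_hcoord hp.
have [a a0 ev] := hcoord_prop h1 hv; have [b b0 ef] := hcoord_prop h2 hf.
rewrite vec3Z mulr0 in ev; rewrite row3Z mulr0 mulrN in ef.
exists a, b; split => //; move: e; rewrite ev ef [dv]vec3_eta [df]row3_eta.
rewrite !row3_vec3 => /rowP/(_ 0); rewrite !mxE !eqxx /= !mulr1n => <-; ring.
Qed.

Lemma qform_tangent P (p : 'cV[R]_2) (a b : R) z : hcoord p P -> H2 z -> a != 0 ->
  b != 0 -> 0 < qform z (a * p 0 0) (a * p 1 0) /\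
    0 < qform z (- (b * p 0 0)) (- (b * p 1 0)).
Proof.
move=> hp hz a0 b0; have := col2_neq0 (hcoord_neq0 hp) => p0.
by split; apply: qform_gt0 => //; rewrite ?oppr_eq0 !mulf_eq0 ?(negPf a0) ?(negPf b0).
Qed.

Lemma flag_norm_continuous_at u w (P : RP1 R) : T1H2 u -> tangent (std_flag P) w ->
  {for (u, w), continuous flag_norm}.
Proof.
case: w => [[v f] [dv df]] [hz _] tw; have hp := hcoord_repr P.
have [a [b [a0 b0 ev ef _]]] := tangent_std_flagP hp tw.
have [qv qf] := qform_tangent hp hz a0 b0.
set X := (u, _).
have cid : {for X, continuous (fun Y : ((R * R) * (R * R)) * tvec R => Y)}.
  exact: cvg_id.
have cz := fun_continuous_fst (fun_continuous_fst cid).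
have cw := fun_continuous_snd cid.
have cv := fun_continuous_fst (fun_continuous_fst cw).
have cf := fun_continuous_snd (fun_continuous_fst cw).
have cdv := fun_continuous_fst (fun_continuous_snd cw).
have cdf := fun_continuous_snd (fun_continuous_snd cw).
have cq (x y : ((R * R) * (R * R)) * tvec R -> R) : {for X, continuous x} ->
  {for X, continuous y} -> {for X, continuous (fun Y => qform Y.1.1 (x Y) (y Y))}.
  move=> cx cy; have cz1 := fun_continuous_fst cz; have cz2 := fun_continuous_snd cz.
  apply: fun_continuous_div => //; first by rewrite gt_eqF.
  apply: fun_continuousD; apply: fun_continuousX.
    by apply: fun_continuousB => //; apply: fun_continuousM.
  exact: fun_continuousM.
have cqv := fun_continuous_sqrt
  (cq _ _ (fun_continuous_coord 0 0 cv) (fun_continuous_coord 2 0 cv)).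
have cqf := fun_continuous_sqrt
  (cq _ _ (fun_continuous_coord 0 2 cf)
     (fun_continuousN (fun_continuous_coord 0 0 cf))).
have nv : Num.sqrt (qform X.1.1 (X.2.1.1 0 0) (X.2.1.1 2 0)) != 0.
  by rewrite gt_eqF // sqrtr_gt0 /= ev !mxE.
have nf : Num.sqrt (qform X.1.1 (X.2.1.2 0 2) (- X.2.1.2 0 0)) != 0.
  by rewrite gt_eqF // sqrtr_gt0 /= ef !mxE.
apply: fun_continuousD; [apply: fun_continuousD|]; apply: fun_continuous_div => //.
- exact: fun_continuous_norm (fun_continuous_coord 1 0 cdv).
- by rewrite mulf_neq0.
- apply: fun_continuous_norm; apply: fun_continuousD; [apply: fun_continuousD|];
    by apply: fun_continuousM; apply: fun_continuous_coord.
- exact: fun_continuousM.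
- exact: fun_continuous_norm (fun_continuous_coord 0 1 cdf).
Qed.

End AnosovProperty.

Section InvariantNorms.
Context (R : realType) (G : groupType) (rho : G -> PSL2 R) (rhot : G -> SL R 2).
Hypothesis lift : forall gamma, PSL2_of (rhot gamma) = rho gamma.
Implicit Types (u : (R * R) * (R * R)) (w : tvec R) (P : RP1 R).

Lemma sqrt_qformZ (z : R * R) k x y :
  Num.sqrt (qform z (k * x) (k * y)) = `|k| * Num.sqrt (qform z x y).
Proof. by rewrite qformZ sqrtrM ?sqr_ge0 // sqrtr_sqr. Qed.

(** The extra terms [da v] and [db f] are invisible, since [v] and [f] have middle entry 0 and
    [f v = 0]. The remaining factors [a], [b] cancel against those in the denominators. *)
Lemma flag_norm_rescale P u w (a b da db : R) : T1H2 u -> tangent (std_flag P) w ->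
  a != 0 -> b != 0 ->
  flag_norm (u, tangent_rescale a b da db w) = flag_norm (u, w).
Proof.
case: w => [[v f] [dv df]] [hz _] tw a0 b0; have hp := hcoord_repr P.
have [a1 [b1 [a10 b10 ev ef _]]] := tangent_std_flagP hp tw.
have [qv qf] := qform_tangent hp hz a10 b10.
rewrite /flag_norm /= ev ef !mxE /=.
move: qv qf; set p0 := \val (repr P) 0 0; set p1 := \val (repr P) 1 0 => qv qf.
rewrite -[- (b * (b1 * p1))]mulrN !mulr0 !addr0 !sqrt_qformZ.
set A := Num.sqrt (qform _ p0 p1); set B := Num.sqrt (qform _ (- _) _).
have A0 : A != 0.
  rewrite gt_eqF // sqrtr_gt0; move: qv.
  by rewrite qformZ pmulr_rgt0 // exprn_even_gt0.
have B0 : B != 0 by rewrite gt_eqF // sqrtr_gt0.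
rewrite !(mulr0, mul0r, addr0).
have -> : b * (b1 * p1) * (a * dv 0 0 + da * (a1 * p0)) +
    b * - (b1 * p0) * (a * dv 2 0 + da * (a1 * p1))
  = b * a * (b1 * p1 * dv 0 0 - b1 * p0 * dv 2 0) by ring.
by rewrite mulNr !normrM; field; rewrite !normr_eq0 A0 B0 a0 b0 a10.
Qed.

Lemma flag_norm_scale u w s :
  flag_norm (u, tangent_scale s w) = `|s| * flag_norm (u, w).
Proof.
case: w => [[v f] [dv df]]; rewrite /flag_norm /= !mxE.
have -> : f 0 0 * (s * dv 0 0) + f 0 1 * (s * dv 1 0) + f 0 2 * (s * dv 2 0)
  = s * (f 0 0 * dv 0 0 + f 0 1 * dv 1 0 + f 0 2 * dv 2 0) by ring.
by rewrite !normrM; ring.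
Qed.

Lemma flag_norm_triangle u w w' : w.1 = w'.1 ->
  flag_norm (u, tangent_add w w') <= flag_norm (u, w) + flag_norm (u, w').
Proof.
case: w w' => [[v f] [dv df]] [[v' f'] [dv' df']] /= [<- <-].
rewrite /flag_norm /= !mxE; set A := Num.sqrt _; set B := Num.sqrt (qform _ (f _ _) _).
have A0 : 0 <= A^-1 by rewrite invr_ge0 sqrtr_ge0.
have B0 : 0 <= B^-1 by rewrite invr_ge0 sqrtr_ge0.
have AB0 : 0 <= (A * B)^-1 by rewrite invr_ge0 mulr_ge0 ?sqrtr_ge0.
rewrite (addrACA (_ + _)) (addrACA (`|dv 1 0| / _)) -!mulrDl.
rewrite !lerD // ler_wpM2r // (le_trans _ (ler_normD _ _)) //.
by rewrite le_eqVlt; apply/orP; left; apply/eqP; congr `|_|; ring.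
Qed.

(** The three terms control the middle entries of [dv] and [df] and the value [f dv]. If they
    vanish, [dv] is a multiple of [v]; tangency turns [f dv = 0] into [df v = 0], which makes [df] a
    multiple of [f]. *)
Lemma flag_norm_definite P u w : T1H2 u -> tangent (std_flag P) w ->
  flag_norm (u, w) = 0 -> tangent_null w.
Proof.
case: w => [[v f] [dv df]] [hz _] tw; have hp := hcoord_repr P.
have [a [b [a0 b0 ev ef e]]] := tangent_std_flagP hp tw.
have [qv qf] := qform_tangent hp hz a0 b0.
have n0 := col2_neq0 (hcoord_neq0 hp); move: qv qf ev ef e n0.
set p0 := \val (repr P) 0 0; set p1 := \val (repr P) 1 0 => qv qf ev ef e n0.
rewrite /flag_norm /= ev ef !mxE /=.
set A := Num.sqrt _; set B := Num.sqrt (qform _ (- _) _).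
have A0 : 0 < A by rewrite sqrtr_gt0.
have B0 : 0 < B by rewrite sqrtr_gt0.
have AB0 : 0 < A * B by rewrite mulr_gt0.
have div0 (x d : R) : 0 < d -> `|x| / d = 0 -> x = 0.
  by move=> d0 /eqP; rewrite mulf_eq0 invr_eq0 (gt_eqF d0) orbF normr_eq0 => /eqP.
move=> /eqP; rewrite !paddr_eq0 ?addr_ge0 ?divr_ge0 ?(ltW A0) ?(ltW B0) ?(ltW AB0) //.
move=> /andP[/andP[/eqP/(div0 _ _ A0) e1 /eqP/(div0 _ _ AB0) e2] /eqP/(div0 _ _ B0) e3].
rewrite mul0r addr0 mulNr in e2.
have e4 : df 0 0 * p0 + df 0 2 * p1 = 0.
  apply: (mulfI a0); rewrite mulr0 -[RHS]e e2 add0r; ring.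
have e5 : p1 * dv 0 0 = p0 * dv 2 0.
  by apply: (mulfI b0); apply/subr0_eq; rewrite -[RHS]e2; ring.
split.
  have [z0|z0] := eqVneq p0 0.
    have z1 : p1 != 0 by move: n0; rewrite z0 eqxx.
    exists (dv 2 0 / (a * p1)); rewrite vec3Z [LHS]vec3_eta e1 z0 !mulr0.
    congr vec3; last by field; rewrite z1.
    by apply: (mulfI z1); rewrite e5 z0 mul0r mulr0.
  exists (dv 0 0 / (a * p0)); rewrite vec3Z [LHS]vec3_eta e1 !mulr0.
  congr vec3; first by field; rewrite z0.
  by apply: (mulfI z0); rewrite -e5; field; rewrite z0.
have [z0|z0] := eqVneq p0 0.
  have z1 : p1 != 0 by move: n0; rewrite z0 eqxx.
  exists (df 0 0 / (b * p1)); rewrite row3Z [LHS]row3_eta e3 z0 !(mulr0, oppr0).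
  congr row3; first by field; rewrite z1.
  by apply: (mulfI z1); move: e4; rewrite z0 mulr0 add0r mulrC => ->; rewrite mulr0.
exists (- df 0 2 / (b * p0)); rewrite row3Z [LHS]row3_eta e3 !mulr0.
congr row3; last by field; rewrite z0.
by apply: (mulfI z0); apply/subr0_eq; rewrite -[RHS]e4; field; rewrite z0 b0.
Qed.

(** Under the determinant pairing the outer entries of [f] correspond to the vector
    [(f 0 2, - f 0 0)], on which [A] acts as on vectors, so [qform_mobius] handles both
    denominators. The numerators are the pairing [f dv] and two middle entries, which [iota_emb]
    leaves fixed. *)
Lemma flag_norm_invariant gamma u w : T1H2 u ->
  flag_norm (PSL2_T1_act (rho gamma) u, tangent_act (iota_emb (rhot gamma)) w)
  = flag_norm (u, w).
Proof.
case: w => [[v f] [dv df]] [hz _]; rewrite /flag_norm /=.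
have -> : mobius (repr (rho gamma)) u.1 = mobius (rhot gamma) u.1.
  by rewrite -lift; exact: PSL2_mobius_of.
set A := rhot gamma.
have -> : f *m invmx (iota_emb A) =
    row3 (f 0 0 * A 1 1 - f 0 2 * A 1 0) (f 0 1) (f 0 2 * A 0 0 - f 0 0 * A 0 1).
  by rewrite {1}[f]row3_eta row3_iotaV.
have -> : df *m invmx (iota_emb A) =
    row3 (df 0 0 * A 1 1 - df 0 2 * A 1 0) (df 0 1) (df 0 2 * A 0 0 - df 0 0 * A 0 1).
  by rewrite {1}[df]row3_eta row3_iotaV.
have -> : iota_emb A *m v =
    vec3 (A 0 0 * v 0 0 + A 0 1 * v 2 0) (v 1 0) (A 1 0 * v 0 0 + A 1 1 * v 2 0).
  by rewrite {1}[v]vec3_eta iota_vec3.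
have -> : iota_emb A *m dv =
    vec3 (A 0 0 * dv 0 0 + A 0 1 * dv 2 0) (dv 1 0) (A 1 0 * dv 0 0 + A 1 1 * dv 2 0).
  by rewrite {1}[dv]vec3_eta iota_vec3.
rewrite !mxE /= qform_mobius //.
have -> : f 0 2 * A 0 0 - f 0 0 * A 0 1 = A 0 0 * f 0 2 + A 0 1 * (- f 0 0) by ring.
have -> : - (f 0 0 * A 1 1 - f 0 2 * A 1 0) = A 1 0 * f 0 2 + A 1 1 * (- f 0 0).
  by ring.
rewrite qform_mobius //; congr (_ + `|_| / _ + _).
rewrite -[f 0 0 * dv 0 0]mul1r -[f 0 2 * dv 2 0]mul1r -(SL2_det A); ring.
Qed.

(** [flag_norm] sees [u] only through its base point and is a norm at every flag of the curve, so
    one family serves both bundles, whatever the endpoint map [e]. *)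
Lemma flag_norm_invariant_norms e :
  invariant_norms rho (rho_0 rhot) (@std_flag R) e (@flag_norm R).
Proof.
split.
- by move=> u w a b da db [hu tw]; exact: flag_norm_rescale tw.
- by move=> u w s _; exact: flag_norm_scale.
- by move=> u w w' _ _; exact: flag_norm_triangle.
- by move=> u w [hu tw]; exact: flag_norm_definite tw.
- apply: continuous_in_subspaceT => -[u w]; rewrite inE => -[hu tw].
  exact: flag_norm_continuous_at hu tw.
- by move=> gamma u w [hu _]; exact: flag_norm_invariant.
Qed.

End InvariantNorms.

(** * Expansion and contraction along the geodesic flow *)

Section GeodesicFlow.
Context (R : realType).
Implicit Types (u : (R * R) * (R * R)) (w : tvec R) (P : RP1 R) (A : SL R 2).

(* The bottom row (c, d) of an isometry carrying the upward unit vector at i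
   to (z, w) is a solution of (c i + d)^2 = i / w. *)
Lemma T1_act_transitive u : T1H2 u -> exists A, T1_act A (axis_velocity 0) = u.
Proof.
case: u => [[X Y] [p q]] [/= Y0 pq].
(* With [s = d + i c] and [w = p + i q] these are the real and imaginary parts of [s^2 w = i]. Since
   [|w| = Y], the number [i / w] is [(q + i p) / Y^2]. *)
have [s [es1 es2]] : exists s : R[i],
    (complex.Re s ^+ 2 - complex.Im s ^+ 2) * p
      - 2 * complex.Re s * complex.Im s * q = 0 /\
    (complex.Re s ^+ 2 - complex.Im s ^+ 2) * q
      + 2 * complex.Re s * complex.Im s * p = 1.
  exists (sqrtc ((q / Y ^+ 2) +i* (p / Y ^+ 2))%C).
  have := sqr_sqrtc ((q / Y ^+ 2) +i* (p / Y ^+ 2))%C.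
  case: (sqrtc _) => d c /eqP; rewrite expr2 eq_complex /= => /andP[/eqP e1 /eqP e2].
  have Y20 : Y ^+ 2 != 0 by rewrite expf_neq0 // gt_eqF.
  have {}e1 : d ^+ 2 - c ^+ 2 = q / Y ^+ 2 by rewrite -e1; ring.
  have {}e2 : 2 * d * c = p / Y ^+ 2 by rewrite -e2; ring.
  rewrite e1 e2; split; first ring.
  rewrite -[RHS](divff Y20) -[X in _ = X / _]pq; ring.
case: s es1 es2 => d c /= es1 es2.
have n2 : (c ^+ 2 + d ^+ 2) ^+ 2 * Y ^+ 2 = 1.
  have <- : ((d ^+ 2 - c ^+ 2) * p - 2 * d * c * q) ^+ 2 +
      ((d ^+ 2 - c ^+ 2) * q + 2 * d * c * p) ^+ 2 = 1.
    by rewrite es1 es2 expr0n expr1n add0r.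
  by rewrite -pq; ring.
have n1 : Y * (c ^+ 2 + d ^+ 2) = 1.
  have n0 : 0 <= Y * (c ^+ 2 + d ^+ 2) by rewrite mulr_ge0 ?addr_ge0 ?sqr_ge0 // ltW.
  by apply/eqP; rewrite -(@eqrXn2 _ 2) ?ler01 // expr1n exprMn mulrC n2.
(* The top row is forced by [a i + b = z (c i + d)] with [z = X + i Y]. *)
pose M : 'M[R]_2 := \matrix_(i, j)
  if i == 0 then (if j == 0 then X * c + Y * d else X * d - Y * c)
  else (if j == 0 then c else d).
have dM : \det M == 1.
  by rewrite det_mx2 !mxE /=; apply/eqP; rewrite -[RHS]n1; ring.
exists (MkSL dM); rewrite /T1_act mobiusE /cocycle_norm /axis_velocity /=.
rewrite to_C_affine !mxE /= !mulr0 !add0r !expR0 !mulr1 expr1n mulr1.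
have D0 : d ^+ 2 + c ^+ 2 != 0.
  by apply/eqP => e; move: n1; rewrite addrC e mulr0 => /eqP; rewrite eq_sym oner_eq0.
congr pair.
  congr pair; apply: (mulIf D0); rewrite divfK //; first ring.
  by rewrite -n1; ring.
rewrite -[RHS](@to_CK R); congr of_C.
have cd0 : (d +i* c)%C != 0.
  apply: contra D0 => /eqP[-> ->]; rewrite expr0n addr0 //.
apply: (mulIf (expf_neq0 2 cd0)); rewrite divfK ?expf_neq0 //.
apply/eqP; rewrite expr2 eq_complex /=; apply/andP; split; apply/eqP.
  by rewrite -[LHS]es1; ring.
by rewrite -[LHS]es2; ring.
Qed.

Lemma frameP u : T1H2 u -> T1_act (frame u) (axis_velocity 0) = u.
Proof.
by move=> /T1_act_transitive; exact: (@xgetPex _ 1%g [set A | T1_act A (axis_velocity 0) = u]).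
Qed.

Lemma frame_base u : T1H2 u -> u.1 = mobius (frame u) (0, 1).
Proof.
by move=> /frameP {1}<-; rewrite /T1_act /axis_velocity /= expR0.
Qed.

Lemma geodesic_flow_base t u : (geodesic_flow t u).1 = mobius (frame u) (0, expR t).
Proof. by []. Qed.

Lemma hcoord_basis (A : SL R 2) (j : 'I_2) :
  hcoord (\col_i A i j) (act A (basis_pt R j)).
Proof.
have := hcoord_act A (ex_intro _ (basis_vector_neq0 R j) erefl).
rewrite -/(basis_pt R j); suff -> : A *m delta_mx j 0 = \col_i A i j by [].
by rewrite -colE; apply/colP => i; rewrite !mxE.
Qed.

(** The outer entries of [v] and the vector [(f 0 2, - f 0 0)] are both multiples of [p], so the
    same [k] governs both denominators. *)
Lemma flag_norm_dilate P (p : 'cV[R]_2) u u' w k : hcoord p P ->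
  tangent (std_flag P) w -> 0 < k ->
  qform u'.1 (p 0 0) (p 1 0) = k ^+ 2 * qform u.1 (p 0 0) (p 1 0) ->
  flag_norm (u', w) = let: ((v, f), (dv, df)) := w in
    let qv := Num.sqrt (qform u.1 (v 0 0) (v 2 0)) in
    let qf := Num.sqrt (qform u.1 (f 0 2) (- f 0 0)) in
    k^-1 * (`|dv 1 0| / qv) + k^-1 ^+ 2 *
    (`|f 0 0 * dv 0 0 + f 0 1 * dv 1 0 + f 0 2 * dv 2 0| / (qv * qf))
    + k^-1 * (`|df 0 1| / qf).
Proof.
case: w => [[v f] [dv df]] hp tw k0 e.
have [a [b [_ _ ev ef _]]] := tangent_std_flagP hp tw.
rewrite /flag_norm ev ef !mxE /= -!mulrN !sqrt_qformZ.
have eN z : qform z (- p 0 0) (- p 1 0) = qform z (p 0 0) (p 1 0).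
  by rewrite /qform; congr (_ / _); ring.
rewrite !eN e sqrtrM ?sqr_ge0 // sqrtr_sqr (gtr0_norm k0).
by rewrite !invfM; ring.
Qed.

(** The slowest weight decides: [k^-1 <= k^-2] for [k <= 1]. For [k >= 1] the reversed inequality
    gives the contraction. *)
Lemma flag_norm_expand P (p : 'cV[R]_2) u u' w k : hcoord p P ->
  tangent (std_flag P) w -> 0 < k <= 1 ->
  qform u'.1 (p 0 0) (p 1 0) = k ^+ 2 * qform u.1 (p 0 0) (p 1 0) ->
  k^-1 * flag_norm (u, w) <= flag_norm (u', w).
Proof.
move=> hp tw /andP[k0 k1] e; rewrite (flag_norm_dilate hp tw k0 e).
case: w tw => [[v f] [dv df]] tw; rewrite /flag_norm /= !mulrDr.
have ki : 1 <= k^-1 by rewrite invf_ge1.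
rewrite lerD2r lerD2l ler_wpM2r ?divr_ge0 ?mulr_ge0 ?sqrtr_ge0 //.
by rewrite expr2 ler_peMl // invr_ge0 ltW.
Qed.

Lemma flag_norm_contract P (p : 'cV[R]_2) u u' w k : hcoord p P ->
  tangent (std_flag P) w -> 1 <= k ->
  qform u'.1 (p 0 0) (p 1 0) = k ^+ 2 * qform u.1 (p 0 0) (p 1 0) ->
  flag_norm (u', w) <= k^-1 * flag_norm (u, w).
Proof.
move=> hp tw k1 e; have k0 : 0 < k by exact: lt_le_trans k1.
rewrite (flag_norm_dilate hp tw k0 e).
case: w tw => [[v f] [dv df]] tw; rewrite /flag_norm /= !mulrDr.
have ki : k^-1 <= 1 by rewrite invf_le1.
rewrite lerD2r lerD2l ler_wpM2r ?divr_ge0 ?mulr_ge0 ?sqrtr_ge0 //.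
by rewrite expr2 ler_piMl // invr_ge0 ltW.
Qed.

End GeodesicFlow.

Section AnosovTheorem.
Context (R : realType) (G : groupType) (rho : G -> PSL2 R) (rhot : G -> SL R 2).

Lemma std_flag_boundary_map :
  (forall gamma, PSL2_of (rhot gamma) = rho gamma) ->
  boundary_map rho (rho_0 rhot) (@std_flag R).
Proof.
move=> lift; split.
- exact: std_flag_continuous.
- move=> gamma x; rewrite -std_flag_equivariant; congr std_flag.
  rewrite /PSL2_act; have := repr_PSL2_of (rhot gamma); rewrite lift => h.
  have hx := hcoord_repr x.
  have h1 := hcoord_act (repr (rho gamma)) hx.
  have h2 := hcoord_act (rhot gamma) hx.
  move: h => /orP[/eqP e|/eqP e]; rewrite e in h1; first exact: hcoord_eq h1 h2.
  have N1 : (-1 : R) != 0 by rewrite oppr_eq0 oner_eq0.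
  have := hcoord_scale N1 h1; rewrite mulNmx scaleN1r opprK => h1'.
  exact: hcoord_eq h1' h2.
- exact: std_flag_transverse.
(* In the frame of [u] the endpoints are [(1, 0)] and [(0, 1)], with square norms [exp(-t)] and
   [exp(t)] at [i e^t]. Thus [k] is [exp(-t/2)] or [exp(t/2)], which gives the rate 1/2 with
   constant 1. *)
- exists (@flag_norm R), (@flag_norm R), 1, (1 / 2); split.
  + by split; [exact: ltr01|rewrite divr_gt0].
  + exact: flag_norm_invariant_norms.
  + exact: flag_norm_invariant_norms.
  + move=> t u w t0 hu tw; rewrite invr1 mul1r.
    have hp := hcoord_basis (frame u) 0.
    rewrite -[expR _]invrK -expRN.
    apply: (flag_norm_expand hp tw).
      by rewrite expR_gt0 -(expR0 R) ler_expR oppr_le0 mulr_ge0 // divr_ge0.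
    rewrite geodesic_flow_base (frame_base hu) !mxE.
    have := qform_mobius (frame u) 1 0 (_ : H2 (0, expR t)).
    have := qform_mobius (frame u) 1 0 (_ : H2 (0, 1)).
    rewrite !mulr1 !mulr0 !addr0 => -> //; last exact: ltr01.
    move=> -> //; last exact: expR_gt0.
    rewrite /qform /= !mul0r !mulr0 !subr0 expr1n expr0n addr0 divr1 mulr1 div1r.
    by rewrite -expRM_natl mulrN expRN div1r mulrA divff // mul1r.
  + move=> t u w t0 hu tw; rewrite mul1r expRN.
    have hp := hcoord_basis (frame u) 1.
    apply: (flag_norm_contract hp tw).
      by rewrite -(expR0 R) ler_expR mulr_ge0 // divr_ge0.
    rewrite geodesic_flow_base (frame_base hu) !mxE.
    have := qform_mobius (frame u) 0 1 (_ : H2 (0, expR t)).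
    have := qform_mobius (frame u) 0 1 (_ : H2 (0, 1)).
    rewrite !mulr1 !mulr0 !add0r => -> //; last exact: ltr01.
    move=> -> //; last exact: expR_gt0.
    rewrite /qform /= !mul0r !subr0 !mulr1 !expr1n expr0n !add0r divr1 mulr1.
    rewrite expr2 mulfK ?gt_eqF ?expR_gt0 //.
    by rewrite -expRM_natl; congr expR; field.
Qed.

Lemma rho_0_Anosov : group_hom rhot ->
  (forall gamma, PSL2_of (rhot gamma) = rho gamma) ->
  Anosov rho (rho_0 rhot) /\ boundary_map rho (rho_0 rhot) (@std_flag R).
Proof.
move=> hom lift; have bm := std_flag_boundary_map lift.
split=> //; split; last by exists (@std_flag R).
by move=> x y; rewrite /rho_0 hom iota_embM.
Qed.

End AnosovTheorem.

(** * Lifting to coverings *)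

(* Cousin's lemma. *)
Lemma interval_induction (R : realType) (I : R -> R -> Prop) :
  (forall a b c : R, 0 <= a -> a <= b -> b <= c -> c <= 1 -> I a b -> I b c -> I a c) ->
  (forall x : R, 0 <= x <= 1 -> exists2 d : R, 0 < d & forall a b : R,
     x - d < a -> a <= x -> x <= b -> b < x + d -> 0 <= a -> b <= 1 -> I a b) ->
  I 0 1.
Proof.
move=> Iadd Iloc; pose S := [set x | 0 <= x <= 1 /\ I 0 x].
have S0 : S 0.
  split; first by rewrite lexx ler01.
  have [|d d0 h] := Iloc 0; first by rewrite lexx ler01.
  by apply: h; rewrite ?lexx ?ler01 // ?sub0r ?oppr_lt0 ?add0r.
have hS : has_sup S by split; [exists 0|exists 1 => x [/andP[]]].
set M := sup S.
have M0 : 0 <= M by apply: ub_le_sup S0; case: hS.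
have M1 : M <= 1 by apply: ge_sup; [exists 0|move=> x [/andP[]]].
have [|d d0 h] := Iloc M; first by rewrite M0 M1.
have [x [/andP[x0 x1] Ix] xM] := sup_adherent d0 hS.
have xleM : x <= M by apply: ub_le_sup; [case: hS|split=> //; rewrite x0 x1].
(* The step of length [d / 2] beyond the supremum is cut off at 1. As [b] cannot exceed [M], the cut
   must have happened and [b = 1]. *)
pose b := Num.min (M + d / 2) 1.
have Mb : M <= b by rewrite /b le_min M1 andbT lerDl divr_ge0 ?ltW.
have b1 : b <= 1 by rewrite /b ge_min lexx orbT.
have bd : b < M + d by rewrite /b gt_min ltrD2l ltr_pdivrMr // ltr_pMr // ltr1n.
have Ib : I 0 b.
  apply: (Iadd 0 x b) => //; first exact: le_trans xleM Mb.
  by apply: h.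
have Sb : b <= M.
  apply: ub_le_sup; first by case: hS.
  by split=> //; rewrite b1 (le_trans M0 Mb).
move: Sb; rewrite /b ge_min => /orP[|h1].
  by rewrite gerDl leNgt divr_gt0.
by move: Ib; rewrite /b min_r // (le_trans h1) // lerDl divr_ge0 // ltW.
Qed.

(** The space acted on is a subset [X] of an ambient space because [H2] lies in [R * R] and the maps
    are total; they are controlled on [X] only. *)
Record covering_action (E S : topologicalType) (G : groupType) (X : set E)
    (act : G -> E -> E) (p : E -> S) : Prop := {
  covering_actX : forall g z, X z -> X (act g z);
  covering_act1 : forall z, X z -> act 1%g z = z;
  covering_actM : forall g h z, X z -> act (g * h)%g z = act g (act h z);
  covering_act_continuous : forall g z, X z -> {for z, continuous (act g)};
  covering_continuous : forall z, X z -> {for z, continuous p};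
  covering_surj : p @` X = setT;
  covering_open : forall U, open U -> open (p @` (U `&` X));
  covering_fibre : forall z w, X z -> X w -> p z = p w <-> exists g, w = act g z;
  covering_wandering : forall z, X z -> exists2 U, nbhs z U &
    forall (g : G) w, g != 1%g -> X w -> U w -> ~ U (act g w)
}.

Section CoveringAction.
Context (R : realType) (E S : topologicalType) (G : groupType).
Variables (X : set E) (act : G -> E -> E) (p : E -> S).
Hypothesis cov : covering_action X act p.

Let actX := covering_actX cov.
Let act1 := covering_act1 cov.
Let actM := covering_actM cov.
Let act_cont := covering_act_continuous cov.
Let p_surj := covering_surj cov.
Let p_open := covering_open cov.
Let p_fibre := covering_fibre cov.
Let p_wandering := covering_wandering cov.

Lemma act_invK g z : X z -> act g^-1%g (act g z) = z.
Proof. by move=> Xz; rewrite -actM // mulVg act1. Qed.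

Lemma act_Kinv g z : X z -> act g (act g^-1%g z) = z.
Proof. by move=> Xz; rewrite -actM // mulgV act1. Qed.

Lemma act_free g z : X z -> act g z = z -> g = 1%g.
Proof.
move=> Xz gz; have [U Uz h] := p_wandering Xz.
apply/eqP; apply: contraT => g1; exfalso.
by apply: (h g z g1 Xz); [|rewrite gz]; apply: nbhs_singleton.
Qed.

Lemma act_inj g h z : X z -> act g z = act h z -> g = h.
Proof.
move=> Xz e; have : act (h^-1 * g)%g z = z.
  by rewrite actM // e act_invK.
move=> /act_free - /(_ Xz) e1; apply: (mulgI h^-1%g).
by rewrite e1 mulVg.
Qed.

(** This makes [p] injective on a wandering set, so that, [p] being open, it has continuous local
    sections. *)
Lemma wandering_inj U z w :
  (forall (g : G) w, g != 1%g -> X w -> U w -> ~ U (act g w)) ->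
  X z -> X w -> U z -> U w -> p z = p w -> z = w.
Proof.
move=> h Xz Xw Uz Uw /p_fibre - /(_ Xz Xw)[g e].
have [g1|g1] := eqVneq g 1%g; first by rewrite e g1 act1.
by exfalso; apply: (h g z g1 Xz Uz); rewrite -e.
Qed.

Lemma p_act g z : X z -> p (act g z) = p z.
Proof. by move=> Xz; apply/esym/p_fibre; [|exact: actX|exists g]. Qed.

(** The element carrying [al] to [be] is locally constant: near [x], both [al] and [g^-1 be] stay in
    one wandering set and in the same fibres, hence coincide. Freeness identifies the elements on
    adjacent intervals. *)
Lemma lifts_differ (al be : R -> E) :
  {within `[0, 1], continuous al} -> {within `[0, 1], continuous be} ->
  (forall t : R, 0 <= t <= 1 -> [/\ X (al t), X (be t) & p (al t) = p (be t)]) ->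
  exists g, forall t : R, 0 <= t <= 1 -> be t = act g (al t).
Proof.
move=> ca cb h.
pose I c d := exists g, forall t, c <= t <= d -> be t = act g (al t).
apply: (interval_induction (I := I)).
  move=> a b c a0 ab bc c1 [g hg] [k hk].
  have b01 : 0 <= b <= 1 by rewrite (le_trans a0 ab) (le_trans bc c1).
  have [Xb _ _] := h b b01.
  have e : g = k.
    by apply: (act_inj Xb); rewrite -hg ?ab ?lexx // -hk ?bc ?lexx.
  exists g => t /andP[a_t tc]; have [tb|/ltW bt] := leP t b.
    by apply: hg; rewrite a_t tb.
  by rewrite e; apply: hk; rewrite bt tc.
move=> x x01; have [Xa Xb /p_fibre - /(_ Xa Xb)[g hg]] := h x x01.
have [U Ux hU] := p_wandering Xa.
have xI : `[0, 1]%classic x by rewrite /= in_itv.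
have na : within `[0, 1]%classic (nbhs x) (fun t => U (al t)).
  by move/subspace_continuousP: ca => /(_ x xI); apply.
have nb : within `[0, 1]%classic (nbhs x) (fun t => U (act g^-1%g (be t))).
  have nU : nbhs (be x) (act g^-1%g @^-1` U).
    by apply: (act_cont Xb); rewrite hg act_invK.
  by move/subspace_continuousP: cb => /(_ x xI _ nU).
have nab : nbhs x (fun t => `[0, 1]%classic t ->
    U (al t) /\ U (act g^-1%g (be t))).
  by apply: filterS2 na nb => t Ua Ub; split.
have [d /= d0 hd] := (nbhs_ballP _ _).1 nab.
exists d => // a b xa ax xb bx a0 b1; exists g => t /andP[a_t tb].
have t01 : 0 <= t <= 1 by rewrite (le_trans a0 a_t) (le_trans tb b1).
have [Xt Xt' e] := h t t01.
have bt : ball x d t.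
  by rewrite /ball /= ltr_distl; apply/andP; split; lra.
have [|Ua Ub] := hd t bt; first by rewrite /= in_itv.
rewrite (_ : al t = act g^-1%g (be t)) ?act_Kinv //.
apply: (wandering_inj hU) => //; first exact: actX.
by rewrite p_act.
Qed.

Section Lifting.
Variable f : R * R -> S.
Hypothesis f_cont : continuous f.

Definition lift_on (A : set (R * R)) := exists Q : R * R -> E,
  {within A, continuous Q} /\ forall s, A s -> X (Q s) /\ p (Q s) = f s.

Lemma lift_on_subset A B : A `<=` B -> lift_on B -> lift_on A.
Proof.
move=> AB [Q [cQ hQ]]; exists Q; split; first exact: continuous_subspaceW cQ.
by move=> s /AB /hQ.
Qed.

(** The lift picks the point of the fibre inside the interior of a wandering set. Its uniqueness
    there and the openness of [p] on smaller sets give continuity. *)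
Lemma lift_on_local (s0 : R * R) : exists2 V, nbhs s0 V & lift_on V.
Proof.
have : [set: S] (f s0) by []. rewrite -p_surj => -[z Xz pz].
have [U Uz hU] := p_wandering Xz.
have oU : open (U^°) := open_interior U.
have UU : U^° `<=` U := @interior_subset _ U.
have oW := p_open oU.
pose F s := [set z' | [/\ U^° z', X z' & p z' = f s]].
pose Q s := xget z (F s).
have W0 : (p @` (U^° `&` X)) (f s0) by exists z.
exists (f @^-1` (p @` (U^° `&` X))).
  by apply: f_cont; apply: open_nbhs_nbhs.
have hQ s : (p @` (U^° `&` X)) (f s) -> F s (Q s).
  by move=> [z' [Uz' Xz'] e]; apply: (@xgetPex _ z (F s)); exists z'.
exists Q; split; last by move=> s /hQ[].
apply: continuous_in_subspaceT => s; rewrite inE => /hQ[UQ XQ pQ] N nN.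
have oN : open (N^° `&` U^°) by apply: openI => //; exact: open_interior.
have fN : (p @` (N^° `&` U^° `&` X)) (f s) by exists (Q s).
have : nbhs s (f @^-1` (p @` (N^° `&` U^° `&` X))).
  by apply: f_cont; apply: open_nbhs_nbhs; split=> //; exact: p_open.
rewrite !nbhs_simpl /=; apply: filterS => s' [z' [[Nz' Uz'] Xz'] e].
have [|UQ' XQ' pQ'] := hQ s'; first by exists z'.
rewrite /= (_ : Q s' = z'); first exact: interior_subset Nz'.
by apply: (wandering_inj hU) => //; [exact: UU|exact: UU|rewrite pQ' e].
Qed.

Lemma lift_on_glue A B (Q1 Q2 : R * R -> E) g : closed A -> closed B ->
  {within A, continuous Q1} -> (forall s, A s -> X (Q1 s) /\ p (Q1 s) = f s) ->
  {within B, continuous Q2} -> (forall s, B s -> X (Q2 s) /\ p (Q2 s) = f s) ->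
  (forall s, A s -> B s -> Q1 s = act g (Q2 s)) -> lift_on (A `|` B).
Proof.
move=> cA cB c1 h1 c2 h2 h12.
have [Q [QA QB]] : exists Q : R * R -> E,
    (forall s, A s -> Q s = Q1 s) /\ (forall s, B s -> Q s = act g (Q2 s)).
  exists (fun s => if `[< A s >] then Q1 s else act g (Q2 s)).
  split=> s; first by move=> As; rewrite asboolT.
  by move=> Bs; case: asboolP => // As; apply: h12.
exists Q; split; last first.
  move=> s [/[dup] /QA -> /h1 //|/[dup] /QB -> /h2[XQ pQ]].
  by split; [exact: actX|rewrite p_act].
apply: withinU_continuous => //.
  apply/subspace_continuousP => s As N nN.
  have {}nN : nbhs (Q1 s) N by rewrite -(QA s As).
  move/subspace_continuousP: c1 => /(_ s As N nN).
  rewrite !nbhs_simpl /=; apply: filterS2 (withinT A _) => t At.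
  by rewrite /from_subspace /= QA.
apply/subspace_continuousP => s Bs N nN.
have {}nN : nbhs (act g (Q2 s)) N by rewrite -(QB s Bs).
have [XQ _] := h2 s Bs.
have {}nN : nbhs (Q2 s) (act g @^-1` N) by exact: act_cont nN.
move/subspace_continuousP: c2 => /(_ s Bs _ nN).
rewrite !nbhs_simpl /=; apply: filterS2 (withinT B _) => t Bt.
by rewrite /from_subspace /= QB.
Qed.

(** Along the common edge, which is a path, the two lifts differ by one element of [G]; translating
    the second lift by it makes them agree there. *)
Lemma lift_on_glue_edge A B (e : R -> R * R) : closed A -> closed B ->
  continuous e -> (forall t : R, 0 <= t <= 1 -> A (e t) /\ B (e t)) ->
  (forall s, A s -> B s -> exists2 t : R, 0 <= t <= 1 & s = e t) ->
  lift_on A -> lift_on B -> lift_on (A `|` B).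
Proof.
move=> cA cB ce he he' [Q1 [c1 h1]] [Q2 [c2 h2]].
have within_edge C (Q : R * R -> E) : (forall t : R, 0 <= t <= 1 -> C (e t)) ->
    {within C, continuous Q} -> {within `[0, 1], continuous (Q \o e)}.
  move=> hC /subspace_continuousP cQ; apply/subspace_continuousP => t.
  rewrite /= in_itv /= => t01 N nN; have := cQ _ (hC t t01) N nN.
  rewrite !nbhs_simpl /= => /(ce t); rewrite !nbhs_simpl /=.
  by apply: filterS => t' h; rewrite /= in_itv /= => t'01; apply: h; exact: hC.
have [g hg] : exists g, forall t : R, 0 <= t <= 1 -> (Q1 \o e) t = act g ((Q2 \o e) t).
  apply: lifts_differ.
  - by apply: (within_edge B) => // t /he[].
  - by apply: (within_edge A) => // t /he[].
  - by move=> t /he[/h1[? e1] /h2[? e2]]; split=> //=; rewrite e1 e2.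
apply: (lift_on_glue (g := g) cA cB c1 h1 c2 h2) => s As Bs.
by have [t /hg /= ht ->] := he' s As Bs.
Qed.

Definition rect (a b c d : R) : set (R * R) := `[a, b] `*` `[c, d].

Lemma rectP a b c d s :
  rect a b c d s <-> (a <= s.1 /\ s.1 <= b) /\ (c <= s.2 /\ s.2 <= d).
Proof.
by rewrite /rect /= !in_itv /=; split=> [[/andP[? ?] /andP[? ?]] //|[[-> ->] [-> ->]]].
Qed.

Lemma rect_closed a b c d : closed (rect a b c d).
Proof.
have -> : rect a b c d = fst @^-1` `[a, b]%classic `&` snd @^-1` `[c, d]%classic by [].
by apply: closedI; apply: preimage_closed; try exact: interval_closed;
  move=> x _; [exact: cvg_fst|exact: cvg_snd].
Qed.

(** Cousin's lemma in each direction takes the place of a fine grid. For fixed [x], vertical gluing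
    produces a lift over a strip around [x] of full height, the width dropping to the smaller one at
    each gluing; the strips are then glued horizontally. *)
Theorem lift_on_square : lift_on (rect 0 1 0 1).
Proof.
pose I x c d := exists2 e : R, 0 < e & forall a b : R,
  x - e < a -> a <= x -> x <= b -> b < x + e -> lift_on (rect a b c d).
have slab x : I x 0 1.
  apply: interval_induction.
    move=> a b c a0 ab bc c1 [e e0 he] [k k0 hk].
    exists (Num.min e k); first by rewrite lt_min e0 k0.
    move=> l r xl lx xr rx.
    have re1 : lift_on (rect l r a b).
      apply: he => //; [apply: le_lt_trans xl|apply: (lt_le_trans rx)].
        by rewrite lerD2l lerN2 ge_min lexx.
      by rewrite lerD2l ge_min lexx.
    have re2 : lift_on (rect l r b c).
      apply: hk => //; [apply: le_lt_trans xl|apply: (lt_le_trans rx)].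
        by rewrite lerD2l lerN2 ge_min lexx orbT.
      by rewrite lerD2l ge_min lexx orbT.
    apply: (@lift_on_subset _ (rect l r a b `|` rect l r b c)).
      move=> s /rectP[h1 [h2 h3]]; have [h4|/ltW h4] := leP s.2 b.
        by left; apply/rectP.
      by right; apply/rectP.
    have lr : l <= r by exact: le_trans lx xr.
    apply: (lift_on_glue_edge (e := fun t => (l + t * (r - l), b))) => //;
      try exact: rect_closed.
    + have ce t : {for t, continuous (fun t : R => (l + t * (r - l), b))}.
        apply: fun_continuous_pair; last exact: cst_continuous.
        apply: fun_continuousD; first exact: cst_continuous.
        by apply: fun_continuousM; [exact: cvg_id|exact: cst_continuous].
      exact: ce.
    + move=> t /andP[t0 t1]; have h0 : 0 <= t * (r - l) by rewrite mulr_ge0 // subr_ge0.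
      have h1 : t * (r - l) <= r - l by rewrite ler_piMl // subr_ge0.
      by split; apply/rectP => /=; split; split; rewrite ?lexx //; lra.
    + move=> [x' y'] /rectP[/= [h1 h2] [h3 h4]] /rectP[/= _ [h5 h6]].
      have e1 : y' = b by apply/eqP; rewrite eq_le h4 h5.
      (* For [l = r] the edge is a single point, and the parameter of the general case would divide
         by 0. *)
      move: lr; rewrite le_eqVlt => /orP[/eqP lr|lr].
        exists 0; first by rewrite lexx ler01.
        by rewrite e1 mul0r addr0; congr pair; apply/eqP; rewrite eq_le h1 lr h2.
      have d0 : 0 < r - l by rewrite subr_gt0.
      exists ((x' - l) / (r - l)).
        rewrite ler_pdivrMr // mul1r lerD2r h2 andbT.
        by apply: divr_ge0; rewrite subr_ge0 // ltW.
      by rewrite divfK ?gt_eqF // e1; congr pair; ring.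
  move=> y y01; have [V nV lV] := lift_on_local (x, y).
  have [e /= e0 he] := (nbhs_ballP _ _).1 nV.
  exists e => // c d yc cy yd dy _ _; exists e => // a b xa ax xb bx.
  apply: lift_on_subset lV => -[x' y'] /rectP[/= [h1 h2] [h3 h4]]; apply: he.
  by split; rewrite /ball /= ltr_distl; apply/andP; split; lra.
apply: (interval_induction (I := fun a b => lift_on (rect a b 0 1))).
  move=> a b c a0 ab bc c1 l1 l2.
  apply: (@lift_on_subset _ (rect a b 0 1 `|` rect b c 0 1)).
    move=> s /rectP[[h2 h3] h1]; have [h4|/ltW h4] := leP s.1 b.
      by left; apply/rectP.
    by right; apply/rectP.
  apply: (lift_on_glue_edge (e := fun t => (b, t))) => //;
    try exact: rect_closed.
  + have ce t : {for t, continuous (fun t : R => (b, t))}.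
      by apply: fun_continuous_pair; [exact: cst_continuous|exact: cvg_id].
    exact: ce.
  + by move=> t /andP[t0 t1]; split; apply/rectP; rewrite /= lexx.
  + move=> [x' y'] /rectP[/= [h1 h2] [h3 h4]] /rectP[/= [h5 h6] _].
    exists y'; first by rewrite h3 h4.
    by congr pair; apply/eqP; rewrite eq_le h2 h5.
move=> x _; have [e e0 he] := slab x; exists e => // a b xa ax xb bx _ _.
exact: he.
Qed.

End Lifting.
End CoveringAction.

(** * Equivariant circle-valued functions *)

Section PolarCoordinates.
Context (R : realType).
Implicit Types (s : R * R) (x y : R).

(** This retraction onto [[0, 1]] serves twice: to extend maps from the square to the plane, and as
    the ramp from which piecewise linear functions are built. *)
Definition clamp x : R := Num.max 0 (Num.min 1 x).

Lemma clamp_id x : 0 <= x <= 1 -> clamp x = x.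
Proof. by move=> /andP[x0 x1]; rewrite /clamp min_r // max_r. Qed.

Lemma clamp_ge1 x : 1 <= x -> clamp x = 1.
Proof. by move=> x1; rewrite /clamp min_l // max_r. Qed.

Lemma clamp_le0 x : x <= 0 -> clamp x = 0.
Proof. by move=> x0; rewrite /clamp min_r ?(le_trans x0) // max_l. Qed.

Lemma clamp01 x : 0 <= clamp x <= 1.
Proof. by rewrite /clamp le_max lexx /= ge_max ler01 /= ge_min lexx. Qed.

Lemma fun_continuous_clamp (T : topologicalType) (f : T -> R) (t : T) :
  {for t, continuous f} -> {for t, continuous (fun u => clamp (f u))}.
Proof.
move=> cf; apply: continuous_max; first exact: cst_continuous.
by apply: continuous_min => //; exact: cst_continuous.
Qed.

Lemma fun_continuous_cos (T : topologicalType) (f : T -> R) (t : T) :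
  {for t, continuous f} -> {for t, continuous (fun u => cos (f u))}.
Proof. by move=> cf; apply: continuous_comp => //; exact: continuous_cos. Qed.

Lemma fun_continuous_sin (T : topologicalType) (f : T -> R) (t : T) :
  {for t, continuous f} -> {for t, continuous (fun u => sin (f u))}.
Proof. by move=> cf; apply: continuous_comp => //; exact: continuous_sin. Qed.

(** The angle is measured in turns, so the unit square covers the disk, with identifications only
    along radius 0 and between the angles 0 and 1. *)
Definition polar s : R * R := (s.1 * cos (2 * pi * s.2), s.1 * sin (2 * pi * s.2)).

Lemma polar_continuous : continuous polar.
Proof.
move=> s; have cid : {for s, continuous (fun t : R * R => t)} by exact: cvg_id.
have c1 := fun_continuous_fst cid; have c2 := fun_continuous_snd cid.
have c3 : {for s, continuous (fun t : R * R => 2 * pi * t.2)}.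
  by apply: fun_continuousM => //; exact: cst_continuous.
have c : {for s, continuous polar}.
  by apply: fun_continuous_pair; apply: fun_continuousM => //;
    [exact: fun_continuous_cos|exact: fun_continuous_sin].
exact: c.
Qed.

Lemma polar_norm s : (polar s).1 ^+ 2 + (polar s).2 ^+ 2 = s.1 ^+ 2.
Proof. by rewrite /= !exprMn -mulrDr cos2Dsin2 mulr1. Qed.

Lemma polar_disk s : 0 <= s.1 <= 1 -> disk (polar s).
Proof.
by move=> /andP[s0 s1]; rewrite /disk /= polar_norm expr_le1.
Qed.

Lemma polar_side g k (t : R) : polar (1, (k%:R + t) / (4 * g)%:R) = side g k t.
Proof. by rewrite /polar /side /= !mul1r mulrA. Qed.

Lemma side_disk g k (t : R) : disk (side g k t).
Proof. by rewrite -polar_side; apply: polar_disk; rewrite /= ler01 lexx. Qed.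

(** The double-angle formula gives [sin (x / 2) = 0], while sine is positive strictly between 0 and
    [pi]. *)
Lemma cos_eq1 x : 0 <= x <= 2 * pi -> cos x = 1 -> x = 0 \/ x = 2 * pi.
Proof.
move=> /andP[x0 x2] c1; have s0 : sin (x / 2) = 0.
  have : cos ((x / 2) *+ 2) = 1 by rewrite -mulr_natr divfK.
  rewrite cos_mulr2n cos2sin2 => h; apply/eqP; rewrite -sqrf_eq0; apply/eqP; lra.
have [->|xn] := eqVneq x 0; [by left|right].
apply/eqP; rewrite eq_le x2 /= leNgt; apply/negP => h.
have /sin_gt0_pi : 0 < x / 2 < pi.
  apply/andP; split; first by rewrite divr_gt0 // lt_def xn.
  by rewrite ltr_pdivrMr // mulrC.
by rewrite s0 ltxx.
Qed.

Lemma cos_sin_inj x y : 0 <= x <= 2 * pi -> 0 <= y <= 2 * pi ->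
  cos x = cos y -> sin x = sin y ->
  [\/ x = y, x = 0 /\ y = 2 * pi | x = 2 * pi /\ y = 0].
Proof.
wlog xy : x y / x <= y.
  move=> H hx hy c s; have [xy|/ltW yx] := leP x y; first exact: H.
  by have [->|[-> ->]|[-> ->]] := H y x yx hy hx (esym c) (esym s);
    [apply: Or31|apply: Or33|apply: Or32].
move=> /andP[x0 x2] /andP[y0 y2] c s.
have : cos (y - x) = 1 by rewrite cosB c s -!expr2 cos2Dsin2.
move=> /cos_eq1[|h|h]; first by apply/andP; split; lra.
  by apply: Or31; lra.
by apply: Or32; split; lra.
Qed.

Lemma polar_inj s t : 0 <= s.1 <= 1 -> 0 <= s.2 <= 1 -> 0 <= t.1 <= 1 ->
  0 <= t.2 <= 1 -> polar s = polar t ->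
  s.1 = t.1 /\ [\/ s.1 = 0, s.2 = t.2, s.2 = 0 /\ t.2 = 1 | s.2 = 1 /\ t.2 = 0].
Proof.
case: s t => [r x] [r' y] /= /andP[r0 _] /andP[x0 x1] /andP[r0' _] /andP[y0 y1] e.
have er : r = r'.
  have := polar_norm (r, x); rewrite e polar_norm /= => /esym/eqP.
  by rewrite eqrXn2 // => /eqP.
split=> //; rewrite -er in e; have [->|rn] := eqVneq r 0; first exact: Or41.
have p0 : 0 < 2 * pi :> R by rewrite mulr_gt0 // pi_gt0.
case: e => /(mulfI rn) c /(mulfI rn) s.
have rg (z : R) : 0 <= z -> z <= 1 -> 0 <= 2 * pi * z <= 2 * pi.
  move=> z0 z1; apply/andP; split; first by apply: mulr_ge0; [exact: (ltW p0)|exact: z0].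
  by apply: ler_piMr; [exact: (ltW p0)|exact: z1].
have z0 (z : R) : 2 * pi * z = 0 -> z = 0.
  by move/eqP; rewrite mulf_eq0 gt_eqF // => /eqP.
have z1 (z : R) : 2 * pi * z = 2 * pi -> z = 1.
  by rewrite -[RHS]mulr1; apply: mulfI; rewrite gt_eqF.
case: (cos_sin_inj (rg x x0 x1) (rg y y0 y1) c s) => [|[/z0-> /z1->]|[/z1-> /z0->]].
- by move=> /(mulfI (lt0r_neq0 p0)); apply: Or42.
- exact: Or43.
- exact: Or44.
Qed.

Lemma polar_surj (v : R * R) : disk v ->
  exists s, [/\ 0 <= s.1 <= 1, 0 <= s.2 <= 1 & polar s = v].
Proof.
case: v => x y; rewrite /disk /= => d.
have n0 : 0 <= x ^+ 2 + y ^+ 2 by rewrite addr_ge0 ?sqr_ge0.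
set r := Num.sqrt (x ^+ 2 + y ^+ 2).
have r0 : 0 <= r by exact: sqrtr_ge0.
have r2 : r ^+ 2 = x ^+ 2 + y ^+ 2 by rewrite sqr_sqrtr.
have r1 : r <= 1 by rewrite -(@expr_le1 _ 2) // r2.
have p0 : 0 < pi :> R by exact: pi_gt0.
have [z|rn] := eqVneq r 0.
  have : x ^+ 2 + y ^+ 2 == 0 by rewrite -r2 z expr0n.
  rewrite paddr_eq0 ?sqr_ge0 // !sqrf_eq0 => /andP[/eqP-> /eqP->].
  by exists (0, 0); rewrite /polar /= !mul0r lexx ler01.
have rp : 0 < r by rewrite lt_def rn.
have sq : 1 - (x / r) ^+ 2 = (y / r) ^+ 2.
  rewrite !exprMn -[1](divff (expf_neq0 2 rn)) {1}r2 -!exprVn; ring.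
have xr : -1 <= x / r <= 1.
  rewrite -ler_norml -(@expr_le1 _ 2) // real_normK ?num_real //.
  by rewrite -subr_ge0 sq sqr_ge0.
have xrI : x / r \in `[(-1), 1] by rewrite in_itv.
have a0 := acos_ge0 xr; have a1 := acos_lepi xr.
have sa : sin (acos (x / r)) = `|y| / r.
  by rewrite sin_acos // sq sqrtr_sqr normrM normfV (ger0_norm r0).
have cancel2pi (z : R) : 2 * pi * (z / (2 * pi)) = z.
  by rewrite mulrC divfK // mulf_neq0 // gt_eqF.
(* [acos] covers the upper half turn only; for [y <= 0] the angle is [2 pi - acos]. *)
have [y0|/ltW y0] := leP 0 y.
  exists (r, acos (x / r) / (2 * pi)); split => /=; first by rewrite r0 r1.
    rewrite divr_ge0 ?mulr_ge0 ?(ltW p0) //= ler_pdivrMr ?mulr_gt0 // mul1r.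
    by rewrite (le_trans a1) // ler_peMl ?(ltW p0) // ler1n.
  rewrite /polar /= cancel2pi acosK // sa ger0_norm //.
  by congr pair; field.
exists (r, (2 * pi - acos (x / r)) / (2 * pi)); split => /=; first by rewrite r0 r1.
  have p2 : 0 < 2 * pi :> R by rewrite mulr_gt0.
  by rewrite ler_pdivrMr // ler_pdivlMr // mul0r mul1r; apply/andP; split; lra.
rewrite /polar /= cancel2pi.
have e2 : 2 * pi - acos (x / r) = - acos (x / r) + pi *+ 2 by ring.
rewrite e2 cosD2pi sinD2pi cosN sinN acosK // sa ler0_norm //.
by congr pair; field.
Qed.

End PolarCoordinates.

(** * A piecewise linear function on the boundary of the polygon with prescribed jumps *)

Section BoundaryFunction.
Context (R : realType) (g : nat) (a b : nat -> R).
Hypothesis g_gt0 : (0 < g)%N.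

(** Glued sides are traversed in opposite directions, so opposite slopes make the difference between
    glued points constant. That constant is the total rise in between, which is why the pair with
    slopes [b], [-b] has jump [a] and the pair with slopes [a], [-a] has jump [-b]. *)
Definition slope (k : nat) : R :=
  match (k %% 4)%N with
  | 0 => b (k %/ 4) | 1 => a (k %/ 4) | 2 => - b (k %/ 4) | _ => - a (k %/ 4)
  end.

(* The piecewise linear function on the boundary of the 4g-gon, parametrised by
   [0, 1], which on the four sides of the i-th handle has slopes b_i, a_i, -b_i,
   -a_i; it is single-valued, and glued points have values differing by a_i or
   b_i. *)
Definition boundary_fun (t : R) : R :=
  \sum_(k < 4 * g) slope k * clamp ((4 * g)%:R * t - k%:R).

Lemma boundary_fun_continuous (T : topologicalType) (f : T -> R) (x : T) :
  {for x, continuous f} -> {for x, continuous (fun y => boundary_fun (f y))}.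
Proof.
move=> cf; rewrite /boundary_fun; elim: (4 * g)%N (4 * g)%:R => [|n IH] c.
  rewrite (_ : (fun y => _) = fun=> 0); first exact: cst_continuous.
  by apply/funext => y; rewrite big_ord0.
rewrite (_ : (fun y => _) = fun y =>
    \sum_(k < n) slope k * clamp (c * f y - k%:R) + slope n * clamp (c * f y - n%:R));
  last by apply/funext => y; rewrite big_ord_recr.
apply: fun_continuousD => //; apply: fun_continuousM; first exact: cst_continuous.
apply: fun_continuous_clamp; apply: fun_continuousB; last exact: cst_continuous.
by apply: fun_continuousM => //; exact: cst_continuous.
Qed.

Lemma boundary_fun_side k (t : R) : (k < 4 * g)%N -> 0 <= t <= 1 ->
  boundary_fun ((k%:R + t) / (4 * g)%:R) = \sum_(j < k) slope j + slope k * t.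
Proof.
move=> kg /andP[t0 t1]; rewrite /boundary_fun.
have g0 : (4 * g)%:R != 0 :> R by rewrite pnatr_eq0 muln_eq0 /= -lt0n.
rewrite mulrC divfK //.
(* On side [k] the ramps of smaller index have reached 1, those of larger index are still 0, and
   only ramp [k] moves. *)
have H n : \sum_(j < n) slope j * clamp (k%:R + t - j%:R) =
    \sum_(j < minn n k) slope j + if (k < n)%N then slope k * t else 0.
  elim: n => [|n IH]; first by rewrite min0n !big_ord0 ltn0 addr0.
  rewrite big_ord_recr /= IH ltnS; have [nk|kn|nk] := ltngtP n k.
  - rewrite (minn_idPl nk) big_ord_recr /= !addr0.
    have h : n%:R + 1 <= k%:R :> R by rewrite natr1 ler_nat.
    by rewrite clamp_ge1 ?mulr1 //; lra.
  - rewrite (minn_idPr (leqW (ltnW kn))).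
    have h : k%:R + 1 <= n%:R :> R by rewrite natr1 ler_nat.
    by rewrite clamp_le0 ?mulr0 ?addr0 //; lra.
  - rewrite nk ?minnn (minn_idPr (leqnSn k)) addr0 clamp_id; first by congr (_ + _ * _); ring.
    by apply/andP; split; lra.
by rewrite H (minn_idPr (ltnW kg)) kg.
Qed.

Lemma slope4 i (j : nat) : slope (4 * i + j) =
  match (j %% 4)%N with
  | 0 => b (i + j %/ 4) | 1 => a (i + j %/ 4)
  | 2 => - b (i + j %/ 4) | _ => - a (i + j %/ 4)
  end.
Proof. by rewrite /slope mulnC modnMDl divnMDl. Qed.

Lemma sum_slope4 i : [/\ \sum_(j < 4 * i) slope j = 0,
  \sum_(j < 4 * i + 1) slope j = b i, \sum_(j < 4 * i + 2) slope j = b i + a i &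
  \sum_(j < 4 * i + 3) slope j = a i].
Proof.
have e1 k : \sum_(j < 4 * k + 1) slope j = \sum_(j < 4 * k) slope j + b k.
  by rewrite addn1 big_ord_recr /= -[X in slope X]addn0 slope4 /= addn0.
have e2 k : \sum_(j < 4 * k + 2) slope j = \sum_(j < 4 * k) slope j + (b k + a k).
  by rewrite [(4 * k + 2)%N]addnS big_ord_recr /= e1 slope4 /= addn0 addrA.
have e3 k : \sum_(j < 4 * k + 3) slope j = \sum_(j < 4 * k) slope j + a k.
  by rewrite [(4 * k + 3)%N]addnS big_ord_recr /= e2 slope4 /= addn0; ring.
have z k : \sum_(j < 4 * k) slope j = 0.
  elim: k => [|k IH]; first by rewrite muln0 big_ord0.
  rewrite mulnS addnC [(4 * k + 4)%N]addnS big_ord_recr /= e3 slope4 /= addn0 IH.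
  ring.
by rewrite e1 e2 e3 z !add0r.
Qed.

Lemma boundary_fun_glued i e (t : R) : (i < g)%N -> (e < 2)%N -> 0 <= t <= 1 ->
  boundary_fun (((4 * i + e + 2)%:R + (1 - t)) / (4 * g)%:R) =
  boundary_fun (((4 * i + e)%:R + t) / (4 * g)%:R) + if e == 0 then a i else - b i.
Proof.
move=> ig e2 t01; have t01' : 0 <= 1 - t <= 1 by move: t01 => /andP[? ?]; apply/andP; split; lra.
have [s0 s1 s2 s3] := sum_slope4 i.
have ig4 : (4 * i + 4 <= 4 * g)%N by rewrite -mulnSr leq_mul2l.
have l k : (k < 4)%N -> (4 * i + k < 4 * g)%N.
  by move=> k4; apply: leq_trans ig4; rewrite ltn_add2l.
have l0 : (4 * i < 4 * g)%N by rewrite -[(4 * i)%N]addn0 l.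
case: e e2 => [|[|//]] _.
  rewrite addn0 !boundary_fun_side ?l // s0 s2 slope4.
  by rewrite -[X in slope X * t]addn0 slope4 /= !addn0; ring.
by rewrite -addnA !boundary_fun_side ?l // s1 s3 !slope4 /= !addn0; ring.
Qed.

Lemma boundary_fun0 : boundary_fun 0 = 0.
Proof.
have g4 : (0 < 4 * g)%N by rewrite muln_gt0.
have := @boundary_fun_side 0 0 g4; rewrite add0r mul0r big_ord0 mulr0 addr0.
by apply; rewrite lexx ler01.
Qed.

Lemma boundary_fun1 : boundary_fun 1 = 0.
Proof.
have g4 : (0 < 4 * g)%N by rewrite muln_gt0.
have g0 : (4 * g)%:R != 0 :> R by rewrite pnatr_eq0 -lt0n.
have [z _ _ _] := sum_slope4 g; have [n gn] : exists n, (4 * g = n.+1)%N.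
  by exists (4 * g).-1; rewrite prednK.
have l : (n < 4 * g)%N by rewrite gn.
have := @boundary_fun_side _ 1 l; rewrite natr1 -gn divff // => ->.
  by move: z; rewrite gn big_ord_recr /= mulr1.
by rewrite ler01 lexx.
Qed.

End BoundaryFunction.

(** * The cone function on the lifted polygon and its equivariant extension *)

Section EquivariantCircleFunction.
Context (R : realType) (g : nat) (E S : topologicalType) (G : groupType).
Variables (X : set E) (act : G -> E -> E) (p : E -> S) (chi : G -> R).
Hypothesis g_gt0 : (0 < g)%N.
Hypothesis cov : covering_action X act p.
Hypothesis X_open : open X.
Hypothesis surf : closed_surface_of_genus R g S.
Hypothesis chiM : forall x y, chi (x * y)%g = chi x * chi y.
Hypothesis chi_sign : forall x, chi x = 1 \/ chi x = -1.

Let square (s : R * R) := 0 <= s.1 <= 1 /\ 0 <= s.2 <= 1.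

Definition circle (x : R) : R * R := (cos (pi * x), sin (pi * x)).

Let sgnmul (c : R) (v : R * R) : R * R := (c * v.1, c * v.2).

(** Only the parity of an integer shift matters for [exp(i pi x)]. Both odd values occur, since the
    jump enters with sign + for [e = 0] and - for [e = 1]. *)
Lemma circle_shift (c a x : R) : c = 1 /\ a = 0 \/ c = -1 /\ (a = 1 \/ a = -1) ->
  circle (x + a) = sgnmul c (circle x).
Proof.
rewrite /circle /sgnmul => -[[-> ->]|[-> [->|->]]] /=.
- by rewrite addr0 !mul1r.
- by rewrite mulrDr mulr1 cosDpi sinDpi !mulN1r.
- have := cosDpi (pi * (x + -1)); have := sinDpi (pi * (x + -1)).
  by rewrite (_ : pi * (x + -1) + pi = pi * x); [move=> -> ->; rewrite !mulN1r !opprK|ring].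
Qed.

Lemma chi1 : chi 1%g = 1.
Proof.
have := chiM 1%g 1%g; rewrite mulg1; have [->//|->] := chi_sign 1%g.
by rewrite mulrNN mulr1.
Qed.

Lemma chiV x : chi x^-1%g = chi x.
Proof.
have := chiM x^-1%g x; rewrite mulVg chi1.
by have [->|->] := chi_sign x; have [->|->] := chi_sign x^-1%g; lra.
Qed.

Lemma chi_sqr x : chi x * chi x = 1.
Proof. by have [->|->] := chi_sign x; rewrite ?mulr1 ?mulrNN ?mulr1. Qed.

Section Polygon.
Variable q : R * R -> S.
Hypothesis q_cont : {within @disk R, continuous q}.
Hypothesis q_surj : q @` @disk R = setT.
Hypothesis q_glued : forall x y, disk x -> disk y ->
  (q x = q y <-> clos_refl_sym_trans _ (glued g) x y).

(** Clamping extends the map to the whole plane, where [lift_on_square] asks for continuity. *)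
Lemma square_map_continuous :
  continuous (fun s : R * R => q (polar (clamp s.1, clamp s.2))).
Proof.
move=> s; set v := fun s : R * R => polar (clamp s.1, clamp s.2).
have dv t : disk (v t) by apply: polar_disk; exact: clamp01.
have cv : {for s, continuous v}.
  apply: continuous_comp; last exact: polar_continuous.
  have cid : {for s, continuous (fun t : R * R => t)} by exact: cvg_id.
  by apply: fun_continuous_pair; apply: fun_continuous_clamp;
    [exact: fun_continuous_fst cid|exact: fun_continuous_snd cid].
move=> N nN; move/subspace_continuousP: q_cont => /(_ _ (dv s) N nN).
rewrite !nbhs_simpl /= => /cv; rewrite !nbhs_simpl /=.
by apply: filterS => t; apply; exact: dv.
Qed.

Lemma polygon_lift : exists Q : R * R -> E,
  {within square, continuous Q} /\
  forall s, square s -> X (Q s) /\ p (Q s) = q (polar s).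
Proof.
have [Q [cQ hQ]] := lift_on_square cov square_map_continuous.
have e : rect 0 1 0 1 = square.
  apply/seteqP; split=> s.
    by move=> /rectP[[? ?] [? ?]]; split; apply/andP.
  by move=> [/andP[? ?] /andP[? ?]]; apply/rectP.
rewrite e in cQ hQ; exists Q; split=> // s sq; have [? ->] := hQ s sq.
by case: sq => ? ?; rewrite !clamp_id // -surjective_pairing.
Qed.

Section Lift.
Variable Q : R * R -> E.
Hypothesis Q_cont : {within square, continuous Q}.
Hypothesis QX : forall s, square s -> X (Q s).
Hypothesis pQ : forall s, square s -> p (Q s) = q (polar s).

(** The centre, the cut ray and the side pairs all give two paths in the square with the same image
    in [S]; this converts each such coincidence into one element of [G]. *)
Lemma square_path_differ (al be : R -> R * R) : continuous al -> continuous be ->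
  (forall t : R, 0 <= t <= 1 -> [/\ square (al t), square (be t) &
     q (polar (al t)) = q (polar (be t))]) ->
  exists x, forall t : R, 0 <= t <= 1 -> Q (be t) = act x (Q (al t)).
Proof.
move=> ca cb h.
have W (c : R -> R * R) : continuous c -> (forall t : R, 0 <= t <= 1 -> square (c t)) ->
    {within `[0, 1], continuous (Q \o c)}.
  move=> cc hc; apply/subspace_continuousP => t.
  rewrite /= in_itv /= => t01 N nN.
  move/subspace_continuousP: Q_cont => /(_ _ (hc t t01) N nN).
  rewrite !nbhs_simpl /= => /(cc t); rewrite !nbhs_simpl /=.
  by apply: filterS => t' H; rewrite /= in_itv /= => t'01; apply: H; exact: hc.
apply: (lifts_differ cov (al := Q \o al) (be := Q \o be)).
- by apply: W => // t /h[].
- by apply: W => // t /h[].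
- by move=> t /h[s1 s2 e] /=; rewrite !pQ //; split=> //; exact: QX.
Qed.

Lemma affine_path_continuous (x0 x1 y0 y1 : R) :
  continuous (fun t : R => (x0 + x1 * t, y0 + y1 * t)).
Proof.
have c t : {for t, continuous (fun t : R => (x0 + x1 * t, y0 + y1 * t))}.
  have cid : {for t, continuous (fun u : R => u)} by exact: cvg_id.
  by apply: fun_continuous_pair; apply: fun_continuousD; try exact: cst_continuous;
    apply: fun_continuousM => //; exact: cst_continuous.
exact: c.
Qed.

Let unit_case (t : R) : 0 <= t <= 1 ->
  [/\ square (0, t), square (t, 0) & square (t, 1)].
Proof. by move=> t01; split; split; rewrite //= ?lexx ?ler01. Qed.

(** Comparison with the constant path gives one [x] with [Q (0, t) = x Q (0, 0)] for all [t], and at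
    [t = 0] this says that [x] fixes [Q (0, 0)]. *)
Lemma lift_center (t : R) : 0 <= t <= 1 -> Q (0, t) = Q (0, 0).
Proof.
move=> t01; have u01 : (0 : R) <= (0 : R) <= 1 by apply/andP; split; [exact: lexx|exact: ler01].
have [|x hx] := square_path_differ (@affine_path_continuous 0 0 0 0)
  (@affine_path_continuous 0 0 0 1).
  move=> u u1; rewrite !mul0r !addr0 add0r mul1r.
  have [h1 _ _] := unit_case u1; have [h2 _ _] := unit_case u01.
  by split=> //; rewrite /polar /= !mul0r.
have := hx t t01; have := hx 0 u01; rewrite !mul0r !mul1r !addr0 !add0r => e0 ->.
by rewrite -e0.
Qed.

(** The two lifts of the ray differ by one element, which fixes their common starting point over the
    centre and is trivial by freeness. *)
Lemma lift_ray (r : R) : 0 <= r <= 1 -> Q (r, 1) = Q (r, 0).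
Proof.
move=> r01; have u01 : (0 : R) <= (0 : R) <= 1 by apply/andP; split; [exact: lexx|exact: ler01].
have o01 : (0 : R) <= (1 : R) <= 1. by apply/andP; split; [exact: ler01|exact: lexx].
have [|x hx] := square_path_differ (@affine_path_continuous 0 1 0 0)
  (@affine_path_continuous 0 1 1 0).
  move=> u u1; rewrite !mul0r !addr0 add0r mul1r.
  have [_ h1 h2] := unit_case u1; split=> //.
  congr q; rewrite /polar /= mulr0 mulr1 cos0 sin0.
  by rewrite mulr_natl cos2pi sin2pi.
have e0 := hx 0 u01; have [s0 _ _] := unit_case u01.
move: e0; rewrite !mul0r !mulr0 !addr0 (lift_center o01) => e0.
have x1 : x = 1%g by apply: (act_free cov (QX s0)); rewrite -e0.
have := hx r r01; rewrite !mul0r !mul1r !addr0 add0r x1 => ->.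
by rewrite (covering_act1 cov) //; apply: QX; have [] := unit_case r01.
Qed.

Definition side_point (k : nat) (t : R) : R * R := (1, (k%:R + t) / (4 * g)%:R).

Lemma side_point_square k t : (k < 4 * g)%N -> 0 <= t <= 1 -> square (side_point k t).
Proof.
move=> kg /andP[t0 t1]; split; rewrite /= ?ler01 ?lexx //.
have g0 : 0 < (4 * g)%:R :> R by rewrite ltr0n muln_gt0.
rewrite divr_ge0 ?addr_ge0 ?ler0n //= ler_pdivrMr // mul1r.
have : k%:R + 1 <= (4 * g)%:R :> R by rewrite natr1 ler_nat.
lra.
Qed.

Let side_lt i e : (i < g)%N -> (e < 2)%N ->
  (4 * i + e < 4 * g)%N /\ (4 * i + e + 2 < 4 * g)%N.
Proof.
move=> ig e2; have ig4 : (4 * i + 4 <= 4 * g)%N by rewrite -mulnSr leq_mul2l.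
split; apply: leq_trans ig4; rewrite -?(addnA (4 * i)) ltn_add2l.
  exact: leq_trans e2 _.
by rewrite addn2 !ltnS.
Qed.

Lemma side_pairing : exists gam : nat -> nat -> G, forall i e (t : R),
  (i < g)%N -> (e < 2)%N -> 0 <= t <= 1 ->
  Q (side_point (4 * i + e) t) = act (gam i e) (Q (side_point (4 * i + e + 2) (1 - t))).
Proof.
(* The range conditions stay inside the statement so that choice applies to all pairs of numbers;
   outside the range 1 is taken. *)
suff /choice[gam h] : forall ie : nat * nat, exists x, forall t : R,
    (ie.1 < g)%N -> (ie.2 < 2)%N -> 0 <= t <= 1 ->
    Q (side_point (4 * ie.1 + ie.2) t)
      = act x (Q (side_point (4 * ie.1 + ie.2 + 2) (1 - t))).
  by exists (fun i e => gam (i, e)) => i e t; exact: (h (i, e)).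
move=> [i e] /=; have [ig|] := boolP (i < g)%N; last by exists 1%g.
have [e2|] := boolP (e < 2)%N; last by exists 1%g.
have [l1 l2] := side_lt ig e2.
pose n := (4 * g)%:R^-1 : R.
have e1 k t : side_point k t = (1 + 0 * t, k%:R * n + n * t).
  by rewrite /side_point mul0r addr0 mulrDl [n * t]mulrC.
have e1' k t : side_point k (1 - t) = (1 + 0 * t, (k%:R + 1) * n + (- n) * t).
  by rewrite /side_point mul0r addr0; congr pair; rewrite /n; ring.
have [|x hx] := square_path_differ
  (@affine_path_continuous 1 0 (((4 * i + e + 2)%:R + 1) * n) (- n))
  (@affine_path_continuous 1 0 ((4 * i + e)%:R * n) n).
  move=> t t01; rewrite -e1 -e1'.
  have t01' : 0 <= 1 - t <= 1 by move: t01 => /andP[? ?]; apply/andP; split; lra.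
  split; [exact: side_point_square|exact: side_point_square|].
  rewrite !polar_side; apply/esym/q_glued; try exact: side_disk.
  by apply: rst_step; exists i, e, t.
by exists x => t _ _ t01; rewrite e1 e1'; exact: hx.
Qed.

Section Twist.
Variable gam : nat -> nat -> G.
Hypothesis gamP : forall i e (t : R), (i < g)%N -> (e < 2)%N -> 0 <= t <= 1 ->
  Q (side_point (4 * i + e) t) = act (gam i e) (Q (side_point (4 * i + e + 2) (1 - t))).

Let jump i e : R := if chi (gam i e) == 1 then 0 else 1.

(* The cone over the boundary function whose jumps are integer lifts of the
   values of chi on the side pairings. *)
Definition polygon_fun (s : R * R) : R :=
  s.1 * boundary_fun g (jump^~ 0%N) (jump^~ 1%N) s.2.

(** The value at [s] is the one that equivariance dictates from the value at [t]. Checking this on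
    the generating identifications and extending it along the closure shows that the circle-valued
    function is single-valued. *)
Definition twisted (s t : R * R) := exists x,
  Q s = act x (Q t) /\ circle (polygon_fun s) = sgnmul (chi x) (circle (polygon_fun t)).

Lemma twisted_eq s t : square t -> Q s = Q t -> polygon_fun s = polygon_fun t ->
  twisted s t.
Proof.
move=> sq eQ eF; exists 1%g; rewrite eQ eF chi1 (covering_act1 cov); last exact: QX.
by split=> //; rewrite /sgnmul /circle /= !mul1r.
Qed.

Lemma polar_eq_twisted s t : square s -> square t -> polar s = polar t -> twisted s t.
Proof.
case: s t => [r x] [r' y] sqs sqt e.
case: (sqs) (sqt) => /= r01 x01 [/= r01' y01].
have [/= er h] := @polar_inj _ (r, x) (r', y) r01 x01 r01' y01 e; rewrite -er in sqt *.
apply: twisted_eq => //; case: h => [r0|->|[-> ->]|[-> ->]] //.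
- by rewrite r0 !lift_center.
- by rewrite lift_ray.
- by rewrite lift_ray.
- by rewrite /polygon_fun r0 /= !mul0r.
- by rewrite /polygon_fun /= boundary_fun0 // boundary_fun1.
- by rewrite /polygon_fun /= boundary_fun0 // boundary_fun1.
Qed.

Lemma twisted_sym s t : square t -> twisted s t -> twisted t s.
Proof.
move=> sq [x [eQ eF]]; exists x^-1%g; split.
  by rewrite eQ (act_invK cov) //; apply: QX.
by rewrite eF chiV /sgnmul /circle /= !mulrA chi_sqr !mul1r.
Qed.

Lemma twisted_trans s t v : square v -> twisted s t -> twisted t v -> twisted s v.
Proof.
move=> sq [x [eQ eF]] [y [eQ' eF']]; exists (x * y)%g; split.
  by rewrite eQ eQ' (covering_actM cov) //; apply: QX.
by rewrite eF eF' chiM /sgnmul /= !mulrA.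
Qed.

Lemma glued_twisted i e (t : R) : (i < g)%N -> (e < 2)%N -> 0 <= t <= 1 ->
  twisted (side_point (4 * i + e) t) (side_point (4 * i + e + 2) (1 - t)).
Proof.
move=> ig e2 t01; exists (gam i e); split; first exact: gamP.
rewrite /polygon_fun /side_point /= !mul1r boundary_fun_glued //.
move: (boundary_fun _ _ _ _) => y.
have jp k : chi (gam i k) = 1 /\ jump i k = 0 \/ chi (gam i k) = -1 /\ jump i k = 1.
  rewrite /jump; have [->|->] := chi_sign (gam i k); rewrite ?eqxx; [by left|right].
  rewrite ifN //; apply/eqP; lra.
case: e e2 => [|[|//]] _ /=.
  rewrite (@circle_shift (chi (gam i 0%N))).
    by rewrite /sgnmul /circle /= !mulrA chi_sqr !mul1r.
  by have [[-> ->]|[-> ->]] := jp 0%N; [left|right; split=> //; left].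
rewrite (@circle_shift (chi (gam i 1%N))).
  by rewrite /sgnmul /circle /= !mulrA chi_sqr !mul1r.
have [[-> ->]|[-> ->]] := jp 1%N; first by rewrite oppr0; left.
by right; split=> //; right.
Qed.

Lemma fibre_twisted s t : square s -> square t -> q (polar s) = q (polar t) ->
  twisted s t.
Proof.
move=> sqs sqt /q_glued h.
have {h} : clos_refl_sym_trans _ (glued g) (polar s) (polar t).
  by apply: h; apply: polar_disk; [case: sqs|case: sqt].
(* The closure lives on points of the plane, [twisted] on parameters in the square, hence the
   quantifier over all polar preimages. Membership in the disk is carried along because the middle
   point of a transitivity step needs a preimage. *)
suff H x y : clos_refl_sym_trans _ (glued g) x y -> (disk x <-> disk y) /\
    (disk x -> forall s t, square s -> square t -> polar s = x -> polar t = y ->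
       twisted s t).
  by move=> /H[_ /(_ _ s t sqs sqt erefl erefl)]; apply; apply: polar_disk; case: sqs.
elim=> {x y} [x y|x|x y _ [d IH]|x y z _ [d IH] _ [d' IH']].
- move=> [i [e [t' [ig e2 t01 -> ->]]]]; split; first by split=> _; exact: side_disk.
  move=> _ {}s {}t {}sqs {}sqt; rewrite -!polar_side => es et.
  have [l1 l2] := side_lt ig e2.
  have t01' : 0 <= 1 - t' <= 1 by move: t01 => /andP[? ?]; apply/andP; split; lra.
  apply: (twisted_trans sqt (polar_eq_twisted sqs (side_point_square l1 t01) es)).
  apply: (twisted_trans sqt (glued_twisted ig e2 t01)).
  exact: (polar_eq_twisted (side_point_square l2 t01') sqt (esym et)).
- by split=> // _ {}s {}t {}sqs {}sqt es et; apply: polar_eq_twisted => //; rewrite es et.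
- split; first by split=> /d.
  move=> /d dx {}s {}t {}sqs {}sqt es et; apply: twisted_sym => //.
  exact: IH.
- split; first by split=> [/d/d'|/d'/d].
  move=> dx {}s {}t {}sqs {}sqt es et.
  have [v [v1 v2 ev]] := polar_surj (d.1 dx).
  apply: (twisted_trans (t := v) sqt); first exact: IH.
  by apply: IH' => //; apply/d.
Qed.

Definition circle_rel (z : E) (c : R * R) := exists s x,
  [/\ square s, z = act x (Q s) & c = sgnmul (chi x) (circle (polygon_fun s))].

(** Two descriptions [x Q s] and [y Q t] of one point have the same image in [S], so [Q s = v Q t]
    with matching values; freeness forces [y = x v], and [chi] is multiplicative. *)
Lemma circle_rel_fun z c c' : circle_rel z c -> circle_rel z c' -> c = c'.
Proof.
move=> [s [x [sqs ez ->]]] [t [y [sqt ez' ->]]].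
have Xs := QX sqs; have Xt := QX sqt.
have : q (polar s) = q (polar t).
  by rewrite -!pQ // -(p_act cov x Xs) -ez ez' (p_act cov).
move=> /(fibre_twisted sqs sqt)[v [eQ ->]].
have -> : y = (x * v)%g.
  by apply: (act_inj cov Xt); rewrite -ez' ez eQ (covering_actM cov).
by rewrite chiM /sgnmul /= !mulrA.
Qed.

Lemma fibre_point z : X z -> exists s x, square s /\ z = act x (Q s).
Proof.
move=> Xz; have : [set: S] (p z) by [].
rewrite -q_surj => -[v dv ev]; have [s [s1 s2 es]] := polar_surj dv.
have sq : square s by [].
have [x ex] : exists x, z = act x (Q s).
  by apply/(covering_fibre cov (QX sq) Xz); rewrite pQ // es.
by exists s, x.
Qed.

Definition circle_fun (z : E) : R * R := xget 0 [set c | circle_rel z c].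

Lemma circle_funE x s : square s ->
  circle_fun (act x (Q s)) = sgnmul (chi x) (circle (polygon_fun s)).
Proof.
move=> sq; have h : circle_rel (act x (Q s)) (sgnmul (chi x) (circle (polygon_fun s))).
  by exists s, x.
apply: (circle_rel_fun _ h).
by apply: (@xgetPex _ 0 [set c | circle_rel (act x (Q s)) c]); eexists; exact: h.
Qed.

Lemma circle_fun_equivariant x z : X z ->
  circle_fun (act x z) = sgnmul (chi x) (circle_fun z).
Proof.
move=> /fibre_point[s [y [sq ->]]].
rewrite -(covering_actM cov); last exact: QX.
by rewrite !circle_funE // chiM /sgnmul /= !mulrA.
Qed.

Lemma circle_fun_norm z : X z ->
  (circle_fun z).1 ^+ 2 + (circle_fun z).2 ^+ 2 = 1.
Proof.
move=> /fibre_point[s [y [sq ->]]]; rewrite circle_funE // /sgnmul /circle /=.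
by rewrite !exprMn expr2 chi_sqr !mul1r cos2Dsin2.
Qed.

Lemma polygon_circle_continuous (s : R * R) c :
  {for s, continuous (fun t => sgnmul c (circle (polygon_fun t)))}.
Proof.
have cid : {for s, continuous (fun t : R * R => t)} by exact: cvg_id.
have cF : {for s, continuous (fun t => pi * polygon_fun t)}.
  apply: fun_continuousM; first exact: cst_continuous.
  apply: fun_continuousM; first exact: fun_continuous_fst cid.
  by apply: boundary_fun_continuous; exact: fun_continuous_snd cid.
by apply: fun_continuous_pair; apply: fun_continuousM; try exact: cst_continuous;
  [exact: fun_continuous_cos cF|exact: fun_continuous_sin cF].
Qed.

Lemma square_compact : compact square.
Proof.
have -> : square = `[0, 1]%classic `*` `[0, 1]%classic.
  by apply/seteqP; split=> -[x y] /=; rewrite !in_itv.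
by apply: compact_setX; exact: segment_compact.
Qed.

(** Compactness of the square replaces local finiteness of the translated polygons: the condition
    [P] is shown for parameters near each [s] and points near [z0], and finitely many such
    neighbourhoods cover the square. *)
Lemma circle_fun_continuous z0 : X z0 -> {for z0, continuous circle_fun}.
Proof.
move=> Xz0 N nN; have [hS _] := surf.
have [U nU hU] := covering_wandering cov Xz0.
have nX : nbhs z0 X by exact: open_nbhs_nbhs.
have Qw s M : square s -> nbhs (Q s) M ->
    nbhs s [set s' | square s' -> M (Q s')].
  by move=> sq nM; move/subspace_continuousP: Q_cont => /(_ s sq M nM).
pose P z s := p z = p (Q s) -> N (circle_fun z).
have near_P : \forall z \near nbhs z0, square `<=` P z.
  apply: ((near_covering_withinP _).2 ((compact_near_coveringP _).1 square_compact)).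
  move=> s sq; have XQ := QX sq.
  (* If [Q s] lies over [p z0], a nearby [z] over [p (Q s')] must be [x Q s'] with the same [x], and
     the function is given by a continuous formula. Otherwise the Hausdorff property separates the
     images and the condition is vacuous. *)
  have [/(covering_fibre cov XQ Xz0)[x ez]|e] := pselect (p (Q s) = p z0).
    have nA1 : nbhs s [set s' | square s' -> U (act x (Q s'))].
      apply: (Qw s (act x @^-1` U)) => //.
      by apply: (covering_act_continuous cov XQ); rewrite -ez.
    have nA2 : nbhs s [set s' | N (sgnmul (chi x) (circle (polygon_fun s')))].
      apply: (@polygon_circle_continuous s (chi x)).
      by rewrite -circle_funE // -ez.
    exists ([set s' | square s' -> U (act x (Q s'))] `&`
            [set s' | N (sgnmul (chi x) (circle (polygon_fun s')))], U `&` X).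
      by split; apply: filterI.
    move=> [s' z] /= [[A1 A2] [Uz Xz]] sq' epz.
    have XQ' := QX sq'.
    rewrite (_ : z = act x (Q s')) ?circle_funE //.
    apply: (wandering_inj cov hU) => //; [exact: (covering_actX cov)|exact: A1|].
    by rewrite (p_act cov).
  move: hS; rewrite open_hausdorff => /(_ (p (Q s)) (p z0)).
  case; first by apply/eqP.
  move=> [A B] /= [] /set_mem Aq /set_mem Bz [oA oB /eqP AB].
  have nA : nbhs s [set s' | square s' -> A (p (Q s'))].
    apply: (Qw s (p @^-1` A)) => //.
    by apply: (covering_continuous cov XQ); apply: open_nbhs_nbhs.
  have nB : nbhs z0 (p @^-1` B).
    by apply: (covering_continuous cov Xz0); apply: open_nbhs_nbhs.
  exists ([set s' | square s' -> A (p (Q s'))], p @^-1` B); first by split.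
  move=> [s' z] /= [h Bp] /h Ap ep; exfalso.
  suff : (A `&` B) (p z) by rewrite AB.
  by split=> //; rewrite ep.
rewrite !nbhs_simpl /=; apply: filterS2 nX near_P => z Xz /= h.
have [s [x [sq ez]]] := fibre_point Xz.
by apply: (h s sq); rewrite ez (p_act cov) //; exact: QX.
Qed.

End Twist.
End Lift.
End Polygon.

(* That is, the flat circle bundle over S with holonomy [chi] has a section. *)
Theorem equivariant_circle_fun : exists u : E -> R * R,
  [/\ forall z, X z -> {for z, continuous u},
      forall z, X z -> (u z).1 ^+ 2 + (u z).2 ^+ 2 = 1 &
      forall x z, X z -> u (act x z) = (chi x * (u z).1, chi x * (u z).2)].
Proof.
have [hS [q [qc qs qg]]] := surf.
have [Q [Qc hQ]] := polygon_lift qc.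
have QX s : square s -> X (Q s) by move=> /hQ[].
have pQ s : square s -> p (Q s) = q (polar s) by move=> /hQ[].
have [gam hgam] := side_pairing qg Qc QX pQ.
exists (circle_fun Q gam); split.
- by move=> z; apply: (circle_fun_continuous (q := q)).
- by move=> z; apply: (circle_fun_norm (q := q)).
- by move=> x z; apply: (circle_fun_equivariant (q := q)).
Qed.

End EquivariantCircleFunction.

(** * The domain Omega *)

Section HyperbolicCovering.
Context (R : realType) (G : groupType) (rho : G -> PSL2 R) (rhot : G -> SL R 2).
Hypothesis rhot_hom : group_hom rhot.
Hypothesis lift : forall gamma, PSL2_of (rhot gamma) = rho gamma.

Lemma H2_open : open (@H2 R).
Proof.
have -> : @H2 R = snd @^-1` [set y : R | 0 < y] by [].
apply: open_comp; last exact: open_gt.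
by move=> z _; exact: cvg_snd.
Qed.

Lemma mobius_continuous (A : SL R 2) z : H2 z -> {for z, continuous (mobius A)}.
Proof.
move=> hz; have -> : mobius A = fun z : R * R =>
  (((A 0 0 * z.1 + A 0 1) * (A 1 0 * z.1 + A 1 1) + A 0 0 * A 1 0 * z.2 ^+ 2)
     / cocycle_norm A z, z.2 / cocycle_norm A z).
  by apply/funext => w; rewrite mobiusE.
have cid : {for z, continuous (fun t : R * R => t)} by exact: cvg_id.
have c1 := fun_continuous_fst cid; have c2 := fun_continuous_snd cid.
have ca (a b : R) : {for z, continuous (fun t : R * R => a * t.1 + b)}.
  apply: fun_continuousD; last exact: cst_continuous.
  by apply: fun_continuousM => //; exact: cst_continuous.
have cD : {for z, continuous (cocycle_norm A)}.
  apply: fun_continuousD; apply: fun_continuousX => //.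
  by apply: fun_continuousM => //; exact: cst_continuous.
have D0 : cocycle_norm A z != 0 by rewrite gt_eqF // cocycle_norm_gt0.
apply: fun_continuous_pair; apply: fun_continuous_div => //.
apply: fun_continuousD; first exact: fun_continuousM.
by apply: fun_continuousM; [exact: cst_continuous|exact: fun_continuousX].
Qed.

Lemma group_hom1 : rhot 1%g = 1%g.
Proof. by apply: (mulgI (rhot 1%g)); rewrite -rhot_hom !mulg1. Qed.

(** An element of PSL(2,R) acts on [H2] as any of its lifts does, so the monodromy may be replaced
    by the homomorphism into SL(2,R). *)
Lemma hyperbolic_covering_action (S : topologicalType) :
  hyperbolic_monodromy S rho ->
  exists p, covering_action (S := S) (@H2 R) (fun gamma => mobius (rhot gamma)) p.
Proof.
move=> [_ [p [pc ps po pf pw]]]; exists p.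
have eqm gamma z : PSL2_mobius (rho gamma) z = mobius (rhot gamma) z.
  by rewrite -lift PSL2_mobius_of.
split=> //.
- by move=> gamma z; exact: mobius_H2.
- by move=> z _; rewrite group_hom1 mobius1.
- by move=> x y z hz; rewrite rhot_hom mobiusM.
- by move=> x z; exact: mobius_continuous.
- move=> z hz; move: pc; rewrite continuous_open_subspace; last exact: H2_open.
  by apply; rewrite inE.
- move=> z w hz hw; rewrite pf //.
  by split=> -[x ->]; exists x; rewrite eqm.
- move=> z hz; have [U nU hU] := pw z hz; exists U => // x w x1 hw Uw.
  by rewrite -eqm; exact: hU.
Qed.

End HyperbolicCovering.

(** * Affine coordinates on Omega *)

Section AffineCoordinates.
Context (R : realType).
Implicit Types (F : Flag R).

Definition proj_ratio m n (i k : 'I_m) (j l : 'I_n) (P : Proj R m n) : R :=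
  (\val (repr P)) i j / (\val (repr P)) k l.

Lemma proj_ratioE m n (i k : 'I_m) (j l : 'I_n) P (v : 'M[R]_(m, n)) :
  hcoord v P -> proj_ratio i k j l P = v i j / v k l.
Proof.
move=> /(hcoord_prop (hcoord_repr P))[c c0 ->]; rewrite !mxE /proj_ratio.
(* Both quotients are 0 by convention when the denominator vanishes. *)
have [->|h] := eqVneq (\val (repr P) k l) 0; first by rewrite mulr0 invr0 !mulr0.
by field; rewrite h c0.
Qed.

Lemma hcoord_pi m n (w : @nonzero R m n) : hcoord (\val w) (\pi_(Proj R m n)%qT w).
Proof.
exists (val_nonzero w); apply/eqmodP/asboolP.
by exists 1; rewrite ?oner_eq0 ?scale1r.
Qed.

(** Invariance of [D] under scaling makes the condition independent of the representative chosen by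
    [repr], so its preimage in the nonzero matrices is the trace of [D]. *)
Lemma proj_open m n (D : set 'M[R]_(m, n)) : open D ->
  (forall w c, c != 0 -> D w -> D (c *: w)) ->
  open [set Q : Proj R m n | D (\val (repr Q))].
Proof.
move=> oD hD; exists D => //; apply/seteqP; split=> w /=; rewrite set_valE => h.
  by have [c c0 ->] := hcoord_prop (hcoord_pi w) (hcoord_repr _); exact: hD.
by have [c c0 ->] := hcoord_prop (hcoord_repr _) (hcoord_pi w); exact: hD.
Qed.

Lemma coord_neq0_open m n (k : 'I_m) (l : 'I_n) :
  open [set w : 'M[R]_(m, n) | w k l != 0].
Proof.
apply: (@open_comp _ _ (fun w : 'M[R]_(m, n) => w k l) [set x | x != 0]).
  by move=> w _; exact: coord_continuous.
exact: open_neq.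
Qed.

Lemma chart_open m n (k : 'I_m) (l : 'I_n) :
  open [set Q : Proj R m n | (\val (repr Q)) k l != 0].
Proof.
apply: (@proj_open m n [set w | w k l != 0]); first exact: coord_neq0_open.
move=> w c c0 /= w0.
by rewrite mxE mulf_neq0.
Qed.

(** [repr] is an arbitrary choice without continuity, so the preimage of an open set is described by
    a scale-invariant open set of matrices. *)
Lemma proj_ratio_continuous m n (i k : 'I_m) (j l : 'I_n) (P : Proj R m n) :
  (\val (repr P)) k l != 0 -> {for P, continuous (proj_ratio i k j l)}.
Proof.
move=> P0 N; rewrite nbhsE => -[B [oB BP] BN].
pose D := [set w : 'M[R]_(m, n) | w k l != 0] `&`
  (fun w : 'M[R]_(m, n) => w i j / w k l) @^-1` B.
have oD : open D.
  pose r (w : 'M[R]_(m, n)) := w i j / w k l.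
  have cr : {in [set w : 'M[R]_(m, n) | w k l != 0], continuous r}.
    move=> w; rewrite inE /= => w0.
    by apply: fun_continuous_div => //; exact: coord_continuous.
  by have /(_ B oB) := (continuous_inP r (@coord_neq0_open m n k l)).1 cr.
have hD w c : c != 0 -> D w -> D (c *: w).
  move=> c0 [/= w0 Bw]; split; rewrite /= !mxE ?mulf_neq0 //.
  rewrite (_ : c * w i j / (c * w k l) = w i j / w k l) //.
  by field; rewrite w0 c0.
have nS : nbhs P [set Q : Proj R m n | D (\val (repr Q))].
  by apply: open_nbhs_nbhs; split; [exact: proj_open|split].
by apply: filterS nS => Q [_ BQ]; exact: BN.
Qed.

Lemma flag_pt_continuous : continuous (@flag_pt R).
Proof.
move=> F; apply: (@continuous_comp _ _ _ set_val fst).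
  exact: initial_continuous.
exact: cvg_fst.
Qed.

Lemma flag_line_continuous : continuous (@flag_line R).
Proof.
move=> F; apply: (@continuous_comp _ _ _ set_val snd).
  exact: initial_continuous.
exact: cvg_snd.
Qed.

Definition aff (F : Flag R) : (R * R) * (R * R) :=
  ((proj_ratio 0 1 0 0 (flag_pt F), proj_ratio 2 1 0 0 (flag_pt F)),
   (proj_ratio 0 0 0 1 (flag_line F), proj_ratio 0 0 2 1 (flag_line F))).

Definition is_aff (F : Flag R) (x y a b : R) :=
  hcoord (vec3 x 1 y) (flag_pt F) /\ hcoord (row3 a 1 b) (flag_line F).

Lemma is_aff_eq F x y a b : is_aff F x y a b -> aff F = ((x, y), (a, b)).
Proof.
move=> [hp hl]; rewrite /aff !(proj_ratioE _ _ _ _ hp) !(proj_ratioE _ _ _ _ hl).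
by rewrite !mxE /= !divr1.
Qed.

Lemma is_aff_rel F x y a b : is_aff F x y a b -> a * x + b * y = -1.
Proof.
move=> [hp hl]; have : incident (flag_line F) (flag_pt F) := set_mem (valP F).
rewrite (incident_hcoord hl hp) row3_vec3_eq0 => /eqP; lra.
Qed.

Lemma is_aff_inj F F' x y a b : is_aff F x y a b -> is_aff F' x y a b -> F = F'.
Proof. by move=> [h1 h2] [h3 h4]; apply: flag_hcoordP h3 h4. Qed.

Lemma OmegaE F : Omega F <->
  (\val (repr (flag_pt F))) 1 0 != 0 /\ (\val (repr (flag_line F))) 0 1 != 0.
Proof.
have hp := hcoord_repr (flag_pt F); have hl := hcoord_repr (flag_line F).
set v := \val (repr (flag_pt F)) in hp *.
set f := \val (repr (flag_line F)) in hl *.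
have e1 : L (flag_pt F) <-> v 1 0 = 0.
  split=> [[x [y h]]|v0].
    by have [c _ ->] := hcoord_prop h hp; rewrite !mxE /= mulr0.
  by exists (v 0 0), (v 2 0); rewrite -v0 -vec3_eta.
have e2 : Ldual (flag_line F) <-> f 0 1 = 0.
  rewrite /Ldual /= (incident_hcoord hl (ex_intro _ (basis_vector_neq0 R 1) erefl)).
  rewrite [f]row3_eta delta_vec3 row3_vec3_eq0 !mulr0 mulr1 add0r addr0 !mxE /=.
  by apply: iff_sym; exact: rwP eqP.
split.
  by move=> [h1 h2]; split; apply/eqP; [move/e1|move/e2].
by move=> [/eqP h1 /eqP h2]; split; [move/e1|move/e2].
Qed.

Lemma Omega_aff F : Omega F -> exists x y a b, is_aff F x y a b.
Proof.
move=> /OmegaE; set v := \val (repr (flag_pt F)); set f := \val (repr (flag_line F)).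
move=> [v0 f0]; exists (v 0 0 / v 1 0), (v 2 0 / v 1 0), (f 0 0 / f 0 1), (f 0 2 / f 0 1).
split.
  have := hcoord_scale (invr_neq0 v0) (hcoord_repr (flag_pt F)).
  rewrite -/v {2}[v]vec3_eta vec3Z mulVf //.
  by rewrite mulrC [_^-1 * v 2 0]mulrC.
have := hcoord_scale (invr_neq0 f0) (hcoord_repr (flag_line F)).
rewrite -/f {2}[f]row3_eta row3Z mulVf //.
by rewrite mulrC [_^-1 * f 0 2]mulrC.
Qed.

Lemma aff_Omega F x y a b : is_aff F x y a b -> Omega F.
Proof.
move=> [hp hl]; apply/OmegaE.
have [c c0 ->] := hcoord_prop hp (hcoord_repr _).
have [d d0 ->] := hcoord_prop hl (hcoord_repr _).
by rewrite !mxE /= !mulr1.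
Qed.

Lemma is_aff_act F x y a b (A : SL R 2) : is_aff F x y a b ->
  is_aff (flag_act (iota_emb A) F) (A 0 0 * x + A 0 1 * y) (A 1 0 * x + A 1 1 * y)
    (a * A 1 1 - b * A 1 0) (b * A 0 0 - a * A 0 1).
Proof.
move=> [hp hl]; split.
  by have := hcoord_act (iota_emb A) hp; rewrite iota_vec3.
by have := hcoord_dual_act (iota_emb A) hl; rewrite row3_iotaV.
Qed.

Lemma Omega_nbhs F : Omega F -> nbhs F (@Omega R).
Proof.
move=> /OmegaE[v0 f0].
have n1 := flag_pt_continuous (open_nbhs_nbhs (conj (@chart_open 3 1 1 0) v0)).
have n2 := flag_line_continuous (open_nbhs_nbhs (conj (@chart_open 1 3 0 1) f0)).
rewrite !nbhs_simpl /= in n1 n2.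
by apply: filterS2 n1 n2 => F' h1 h2; apply/OmegaE.
Qed.

Lemma aff_continuous F : Omega F -> {for F, continuous aff}.
Proof.
move=> /OmegaE[v0 f0].
have c1 i : {for F, continuous (fun F => proj_ratio i 1 0 0 (flag_pt F))}.
  apply: continuous_comp; first exact: flag_pt_continuous.
  exact: proj_ratio_continuous.
have c2 i : {for F, continuous (fun F => proj_ratio 0 0 i 1 (flag_line F))}.
  apply: continuous_comp; first exact: flag_line_continuous.
  exact: proj_ratio_continuous.
by apply: fun_continuous_pair; apply: fun_continuous_pair.
Qed.

Fact aff_pt_subproof (x y : R) : vec3 x 1 y != 0.
Proof. by rewrite vec3_neq0 oner_eq0 /= orbT. Qed.

Fact aff_line_subproof (a b : R) : row3 a 1 b != 0.
Proof. by rewrite row3_neq0 oner_eq0 /= orbT. Qed.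

(** The argument [F] is a default value, returned when the two classes are not incident; under the
    hypothesis of [of_affP] this does not happen. *)
Definition of_aff (F : Flag R) (c : (R * R) * (R * R)) : Flag R :=
  insubd F (cls (aff_pt_subproof c.1.1 c.1.2), cls (aff_line_subproof c.2.1 c.2.2)).

Lemma of_affP F x y a b : a * x + b * y = -1 ->
  is_aff (of_aff F ((x, y), (a, b))) x y a b.
Proof.
move=> e; have h : (cls (aff_pt_subproof x y), cls (aff_line_subproof a b))
    \in @flag_set R.
  apply/mem_set; rewrite /flag_set /= incident_cls row3_vec3_eq0.
  by apply/eqP; rewrite -[RHS](addNr 1) -e; ring.
by rewrite /is_aff /flag_pt /flag_line /of_aff insubdK //; split; eexists.
Qed.

End AffineCoordinates.

Lemma ord2P (P : 'I_2 -> Prop) : P 0 -> P 1 -> forall i, P i.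
Proof.
move=> P0 P1; case=> [[|[|//]]] i.
- by rewrite (_ : Ordinal i = 0) //; apply: val_inj.
- by rewrite (_ : Ordinal i = 1) //; apply: val_inj.
Qed.

(** * Rotating the fibres of Omega over the hyperbolic plane *)

Section FibreRotation.
Context (R : realType).
Implicit Types (F : Flag R) (c : (R * R) * (R * R)) (k : R * R).

(* Omega is identified with SL(2,R), acting on itself by left translations, by
   sending ([x:1:y], [a:1:b]) to the matrix with columns (x, y) and (b, -a); its
   determinant is 1 because a x + 1 + b y = 0.  [base_pt] is the projection
   to H2 = SL(2,R) / SO(2). *)
Definition base_pt c : R * R :=
  ((c.1.1 * c.1.2 - c.2.1 * c.2.2) / (c.1.2 ^+ 2 + c.2.1 ^+ 2),
   1 / (c.1.2 ^+ 2 + c.2.1 ^+ 2)).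

(* Right multiplication by the rotation matrix of k = (cos, sin). *)
Definition rot k c : (R * R) * (R * R) :=
  ((k.1 * c.1.1 + k.2 * c.2.2, k.1 * c.1.2 - k.2 * c.2.1),
   (k.2 * c.1.2 + k.1 * c.2.1, k.1 * c.2.2 - k.2 * c.1.1)).

Definition lact (A : SL R 2) c : (R * R) * (R * R) :=
  ((A 0 0 * c.1.1 + A 0 1 * c.1.2, A 1 0 * c.1.1 + A 1 1 * c.1.2),
   (c.2.1 * A 1 1 - c.2.2 * A 1 0, c.2.2 * A 0 0 - c.2.1 * A 0 1)).

Definition unimod c := c.2.1 * c.1.1 + c.2.2 * c.1.2 = -1.

Lemma unimod_den c : unimod c -> 0 < c.1.2 ^+ 2 + c.2.1 ^+ 2.
Proof.
move=> u; rewrite lt_def addr_ge0 ?sqr_ge0 // andbT paddr_eq0 ?sqr_ge0 //.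
rewrite !sqrf_eq0; apply/negP => /andP[/eqP e1 /eqP e2].
by move: u; rewrite /unimod e1 e2 mulr0 mul0r addr0; lra.
Qed.

Lemma base_pt_H2 c : unimod c -> H2 (base_pt c).
Proof. by move=> /unimod_den h; rewrite /H2 /= divr_gt0. Qed.

Lemma base_pt_lact A c : unimod c -> base_pt (lact A c) = mobius A (base_pt c).
Proof.
case: c => [[x y] [a b]] u.
(* [M c] is the matrix identified with [c], and [base_pt c] is the image of [i] under it, so the
   claim becomes the action law of [mobius]. *)
pose M (c : (R * R) * (R * R)) : 'M[R]_2 := \matrix_(i, j)
  if i == 0 then (if j == 0 then c.1.1 else c.2.2)
  else (if j == 0 then c.1.2 else - c.2.1).
have dM c : unimod c -> \det (M c) == 1.
  by move=> e; rewrite det_mx2 !mxE /=; apply/eqP; move: e; rewrite /unimod; lra.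
have bM c (uc : unimod c) : base_pt c = mobius (MkSL (dM c uc)) (0, 1).
  rewrite mobiusE /cocycle_norm /= !mxE /= /base_pt.
  by congr (_ / _, _ / _); ring.
have uA : unimod (lact A ((x, y), (a, b))).
  move: (u); rewrite /unimod /= => u'.
  by rewrite -u' -[RHS]mul1r -(SL2_det A); ring.
rewrite (bM _ uA) (bM _ u) -mobiusM; last exact: ltr01.
congr mobius; apply: val_inj; apply/matrixP; apply: ord2P; apply: ord2P;
  by rewrite [RHS](SL2_mulE A) !mxE /=; ring.
Qed.

Lemma unimod_rot k c : k.1 ^+ 2 + k.2 ^+ 2 = 1 -> unimod c -> unimod (rot k c).
Proof.
by rewrite /unimod /= => k1 u; rewrite -u -[RHS]mul1r -k1; ring.
Qed.

Lemma base_pt_rot k c : k.1 ^+ 2 + k.2 ^+ 2 = 1 -> base_pt (rot k c) = base_pt c.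
Proof.
move=> k1; rewrite /base_pt /=.
have -> : (k.1 * c.1.2 - k.2 * c.2.1) ^+ 2 + (k.2 * c.1.2 + k.1 * c.2.1) ^+ 2 =
    c.1.2 ^+ 2 + c.2.1 ^+ 2 by rewrite -[RHS]mul1r -k1; ring.
by congr (_ / _, _); rewrite -[RHS]mul1r -k1; ring.
Qed.

Lemma rotK k c : k.1 ^+ 2 + k.2 ^+ 2 = 1 -> rot (k.1, - k.2) (rot k c) = c.
Proof.
move=> k1; rewrite /rot; case: c => [[x y] [a b]] /=.
by congr ((_, _), (_, _)); rewrite -[RHS]mul1r -k1; ring.
Qed.

Variable u : R * R -> R * R.
Hypothesis u_cont : forall z, H2 z -> {for z, continuous u}.
Hypothesis u_norm : forall z, H2 z -> (u z).1 ^+ 2 + (u z).2 ^+ 2 = 1.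

Definition fibre_rot F : Flag R := of_aff F (rot (u (base_pt (aff F))) (aff F)).

Lemma Omega_unimod F : Omega F -> unimod (aff F).
Proof. by move=> /Omega_aff[x [y [a [b h]]]]; rewrite (is_aff_eq h); exact: is_aff_rel h. Qed.

Lemma Omega_is_aff F : Omega F -> is_aff F (aff F).1.1 (aff F).1.2 (aff F).2.1 (aff F).2.2.
Proof. by move=> /Omega_aff[x [y [a [b h]]]]; rewrite (is_aff_eq h). Qed.

Lemma fibre_rot_is_aff F : Omega F ->
  let c := rot (u (base_pt (aff F))) (aff F) in
  is_aff (fibre_rot F) c.1.1 c.1.2 c.2.1 c.2.2.
Proof.
move=> hF; have uF := Omega_unimod hF.
apply: of_affP; apply: (unimod_rot _ uF); apply: u_norm; exact: base_pt_H2.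
Qed.

Lemma aff_fibre_rot F : Omega F ->
  aff (fibre_rot F) = rot (u (base_pt (aff F))) (aff F).
Proof. by move=> /fibre_rot_is_aff /= /is_aff_eq. Qed.

Lemma fibre_rot_Omega F : Omega F -> Omega (fibre_rot F).
Proof. by move=> /fibre_rot_is_aff /= /aff_Omega. Qed.

Lemma fibre_rot_continuous F : Omega F -> {for F, continuous fibre_rot}.
Proof.
move=> hF; have uF := Omega_unimod hF.
have cA := aff_continuous hF.
have c1 := fun_continuous_fst (fun_continuous_fst cA).
have c2 := fun_continuous_snd (fun_continuous_fst cA).
have c3 := fun_continuous_fst (fun_continuous_snd cA).
have c4 := fun_continuous_snd (fun_continuous_snd cA).
have cone : {for F, continuous (fun _ : Flag R => 1 : R)} by exact: cst_continuous.
have cb : {for F, continuous (fun F => base_pt (aff F))}.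
  pose N F' := (aff F').1.1 * (aff F').1.2 - (aff F').2.1 * (aff F').2.2.
  pose D F' := (aff F').1.2 ^+ 2 + (aff F').2.1 ^+ 2.
  have cN : {for F, continuous N}.
    exact: (fun_continuousB (fun_continuousM c1 c2) (fun_continuousM c3 c4)).
  have cD : {for F, continuous D}.
    exact: (fun_continuousD (fun_continuousX (n := 2) c2) (fun_continuousX (n := 2) c3)).
  have D0 : D F != 0 := lt0r_neq0 (unimod_den uF).
  exact: (fun_continuous_pair (fun_continuous_div D0 cN cD)
    (fun_continuous_div D0 cone cD)).
have cu : {for F, continuous (fun F => u (base_pt (aff F)))}.
  by apply: continuous_comp cb _; apply: u_cont; exact: base_pt_H2.
have cu1 := fun_continuous_fst cu; have cu2 := fun_continuous_snd cu.
have nO := Omega_nbhs hF.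
pose C F' := rot (u (base_pt (aff F'))) (aff F').
have c11 : {for F, continuous (fun F' => (C F').1.1)}.
  exact: (fun_continuousD (fun_continuousM cu1 c1) (fun_continuousM cu2 c4)).
have c12 : {for F, continuous (fun F' => (C F').1.2)}.
  exact: (fun_continuousB (fun_continuousM cu1 c2) (fun_continuousM cu2 c3)).
have c21 : {for F, continuous (fun F' => (C F').2.1)}.
  exact: (fun_continuousD (fun_continuousM cu2 c2) (fun_continuousM cu1 c3)).
have c22 : {for F, continuous (fun F' => (C F').2.2)}.
  exact: (fun_continuousB (fun_continuousM cu1 c4) (fun_continuousM cu2 c1)).
have hC F' : Omega F' ->
    is_aff (fibre_rot F') (C F').1.1 (C F').1.2 (C F').2.1 (C F').2.2.
  exact: fibre_rot_is_aff.
move: fibre_rot C c11 c12 c21 c22 hC => h C c11 c12 c21 c22 hC.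
apply: continuous_at_flag.
  apply: (continuous_at_cls _ (continuous_at_vec3 c11 cone c12)).
  by apply: filterS nO => F' /hC[].
apply: (continuous_at_cls _ (continuous_at_row3 c21 cone c22)).
by apply: filterS nO => F' /hC[].
Qed.

Lemma Omega_act A F : Omega F -> Omega (flag_act (iota_emb A) F).
Proof. by move=> /Omega_is_aff/(is_aff_act A)/aff_Omega. Qed.

Lemma aff_act A F : Omega F -> aff (flag_act (iota_emb A) F) = lact A (aff F).
Proof. by move=> /Omega_is_aff/(is_aff_act A)/is_aff_eq ->. Qed.

Lemma Omega_aff_inj F F' : Omega F -> Omega F' -> aff F = aff F' -> F = F'.
Proof.
move=> hF hF' e; apply: (is_aff_inj (Omega_is_aff hF)); rewrite e; exact: Omega_is_aff.
Qed.

(** Right rotation commutes with left translation and is linear in [k]. A factor [s] in the rotation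
    therefore comes out and turns the left factor [A] into [B = s A]. *)
Lemma fibre_rot_equivariant (A B : SL R 2) (s : R) F :
  (forall i j, B i j = s * A i j) -> Omega F ->
  (forall z, H2 z -> u (mobius A z) = (s * (u z).1, s * (u z).2)) ->
  fibre_rot (flag_act (iota_emb A) F) = flag_act (iota_emb B) (fibre_rot F).
Proof.
move=> AB hF hu; have hA := Omega_act A hF; have hR := fibre_rot_Omega hF.
apply: Omega_aff_inj; [exact: fibre_rot_Omega|exact: Omega_act|].
rewrite aff_fibre_rot // aff_act // aff_act // aff_fibre_rot //.
have uF := Omega_unimod hF.
rewrite base_pt_lact // hu; last exact: base_pt_H2.
move: (u (base_pt (aff F))) (aff F) => k c.
by rewrite /rot /lact /= !AB; congr ((_, _), (_, _)); ring.
Qed.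

End FibreRotation.

(** Rotation preserves the base point, so the second map is evaluated at the same [z] and uses
    exactly the inverse rotation. *)
Lemma fibre_rot_cancel (R : realType) (u v : R * R -> R * R) (F : Flag R) :
  (forall z, H2 z -> (u z).1 ^+ 2 + (u z).2 ^+ 2 = 1) ->
  (forall z, H2 z -> v z = ((u z).1, - (u z).2)) ->
  Omega F -> fibre_rot v (fibre_rot u F) = F.
Proof.
move=> u1 uv hF; have uF := Omega_unimod hF; have hz := base_pt_H2 uF.
have v1 z : H2 z -> (v z).1 ^+ 2 + (v z).2 ^+ 2 = 1.
  by move=> Hz; rewrite uv // sqrrN u1.
have hR := fibre_rot_Omega u1 hF.
apply: Omega_aff_inj => //; first exact: fibre_rot_Omega.
rewrite (aff_fibre_rot v1) // (aff_fibre_rot u1) // base_pt_rot ?u1 // uv //.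
by rewrite rotK // u1.
Qed.

Lemma fibre_rot_homeomorphism (R : realType) (u : R * R -> R * R) :
  (forall z, H2 z -> {for z, continuous u}) ->
  (forall z, H2 z -> (u z).1 ^+ 2 + (u z).2 ^+ 2 = 1) ->
  homeomorphism_of (@Omega R) (fibre_rot u).
Proof.
move=> uc u1; pose v z := ((u z).1, - (u z).2).
have v1 z : H2 z -> (v z).1 ^+ 2 + (v z).2 ^+ 2 = 1.
  by move=> hz; rewrite /v sqrrN u1.
have vc z : H2 z -> {for z, continuous v}.
  move=> hz; apply: fun_continuous_pair; first exact: fun_continuous_fst (uc z hz).
  by apply: fun_continuousN; exact: fun_continuous_snd (uc z hz).
exists (fibre_rot v); split.
- by split=> F; exact: fibre_rot_Omega.
- by move=> F; exact: fibre_rot_cancel.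
- move=> F; apply: fibre_rot_cancel => // z hz.
  by rewrite /v /= opprK; case: (u z).
- by apply: continuous_in_subspaceT => F; rewrite inE; exact: fibre_rot_continuous.
- by apply: continuous_in_subspaceT => F; rewrite inE; exact: fibre_rot_continuous.
Qed.

Section Twists.
Context (R : realType) (G : groupType).
Implicit Types (rhot : G -> SL R 2) (phi psi : G -> 'Z_2).

Definition sign_of phi (x : G) : R := (-1) ^+ phi x.

Lemma sign_ofM phi : hom_to_Z2 phi ->
  forall x y, sign_of phi (x * y)%g = sign_of phi x * sign_of phi y.
Proof.
move=> h x y; rewrite /sign_of h -exprD.
case: (phi x) => [[|[|//]]] ?; case: (phi y) => [[|[|//]]] ? //=.
by rewrite [RHS]sqrrN expr1n.
Qed.

Lemma sign_of_cases phi x : sign_of phi x = 1 \/ sign_of phi x = -1.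
Proof.
by rewrite /sign_of; case: (phi x) => [[|[|//]]] ? /=; [left|right; rewrite expr1].
Qed.

Fact negone_subproof : \det (- 1%:M : 'M[R]_2) == 1.
Proof. by rewrite det_mx2 !mxE /=; apply/eqP; ring. Qed.

Definition negone : SL R 2 := MkSL negone_subproof.

Lemma iota_negone : iota_emb negone = J13 R.
Proof.
apply: val_inj; apply/matrixP; apply: ord3P; apply: ord3P; rewrite !mxE /=;
  by rewrite ?oppr0.
Qed.

Definition twist rhot phi (x : G) : SL R 2 := (rhot x * negone ^+ phi x)%g.

Lemma rho_twistE rhot phi : rho_twist rhot phi = rho_0 (twist rhot phi).
Proof.
apply/funext => x; rewrite /rho_twist /rho_0 /twist iota_embM -iota_negone.
congr (_ * _)%g; case: (phi x) => [[|[|//]]] ? /=; rewrite ?expg0 ?expg1 //.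
by apply: (mulgI (iota_emb 1%g)); rewrite -iota_embM !mulg1.
Qed.

Lemma twist_entry rhot phi x i j : twist rhot phi x i j = sign_of phi x * rhot x i j.
Proof.
rewrite /twist /sign_of; case: (phi x) => [[|[|//]]] ?.
  by rewrite expg0 expr0 mulg1 mul1r.
rewrite expg1 expr1 /= mulmxN mulmx1 mxE mulN1r //.
Qed.

Lemma twist_hom rhot phi : group_hom rhot -> hom_to_Z2 phi ->
  group_hom (twist rhot phi).
Proof.
move=> h hphi x y; apply: val_inj; apply/matrixP => i j.
rewrite [RHS](SL2_mulE (twist rhot phi x)) !twist_entry sign_ofM // h.
by rewrite SL2_mulE; ring.
Qed.

Lemma twist_lift rhot phi x : PSL2_of (twist rhot phi x) = PSL2_of (rhot x).
Proof.
apply/PSL2_ofP; rewrite /eq_up_to_sign.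
have e : SLmx (twist rhot phi x) = sign_of phi x *: SLmx (rhot x).
  by apply/matrixP => i j; rewrite [LHS]twist_entry mxE.
rewrite e; have [->|->] := sign_of_cases phi x; rewrite ?scale1r ?scaleN1r eqxx //.
by rewrite orbT.
Qed.

End Twists.

Theorem mainTheorem3 (R : realType) (g : nat) (Sigma : topologicalType)
    (pi1 : groupType) (rho : pi1 -> PSL2 R) (rhot : pi1 -> SL R 2)
    (hg : (2 <= g)%N)
    (hSigma : closed_surface_of_genus R g Sigma)
    (hrho : hyperbolic_monodromy Sigma rho)
    (hrhot : group_hom rhot)
    (hlift : forall gamma, PSL2_of (rhot gamma) = rho gamma) :
  (exists xi : RP1 R -> Flag R,
     [/\ standard_map xi,
         Anosov rho (rho_0 rhot) /\ boundary_map rho (rho_0 rhot) xi &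
         forall phi : pi1 -> 'Z_2, hom_to_Z2 phi ->
           Anosov rho (rho_twist rhot phi) /\
           boundary_map rho (rho_twist rhot phi) xi]) /\
  (forall phi : pi1 -> 'Z_2, hom_to_Z2 phi ->
     forall gamma (F : Flag R), Omega F ->
       Omega (flag_act (rho_twist rhot phi gamma) F)) /\
  (forall phi psi : pi1 -> 'Z_2, hom_to_Z2 phi -> hom_to_Z2 psi ->
     exists h : Flag R -> Flag R,
       homeomorphism_of (@Omega R) h /\
       forall gamma (F : Flag R), Omega F ->
         h (flag_act (rho_twist rhot phi gamma) F) =
         flag_act (rho_twist rhot psi gamma) (h F)).
Proof.
split; [|split].
- exists (@std_flag R); split.
  + exact: std_flag_standard.
  + exact: rho_0_Anosov.
  + move=> phi hphi; rewrite rho_twistE; apply: rho_0_Anosov.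
      exact: twist_hom.
    by move=> gamma; rewrite twist_lift.
- move=> phi hphi gamma F hF; rewrite rho_twistE; exact: Omega_act.
move=> phi psi hphi hpsi.
have [p cov] := hyperbolic_covering_action hrhot hlift hrho.
pose chi x : R := sign_of R phi x * sign_of R psi x.
have chiM x y : chi (x * y)%g = chi x * chi y.
  by rewrite /chi !sign_ofM //; ring.
have chi_sign x : chi x = 1 \/ chi x = -1.
  rewrite /chi; have [->|->] := sign_of_cases R phi x;
    have [->|->] := sign_of_cases R psi x; rewrite ?mulr1 ?mul1r ?mulrNN ?mulr1; auto.
have g0 : (0 < g)%N by exact: leq_trans hg.
have [u [uc u1 ue]] := equivariant_circle_fun g0 cov (@H2_open R) hSigma chiM chi_sign.
exists (fibre_rot u); split; first exact: fibre_rot_homeomorphism.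
move=> gamma F hF; rewrite !rho_twistE /rho_0.
apply: (@fibre_rot_equivariant _ u u1 _ _ (chi gamma)) => //.
  move=> i j; rewrite !twist_entry /chi.
  by have [->|->] := sign_of_cases R phi gamma; ring.
(* The twist and [rhot] differ by a sign, hence induce the same isometry of [H2], for which the
   equivariance of [u] was stated. *)
move=> z hz; rewrite -ue //; congr u.
apply: mobius_eq_up_to_sign; apply/PSL2_ofP; exact: twist_lift.
Qed.
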